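(* In the normal-cell setting described in the context, fix one piece $\alpha$ with $d:=d_\alpha\ge1$ and suppress the index. Suppose there exist: $\boldsymbol\beta\in(0,\infty)^d$, with $Q:=\sum_i\beta_i$; a measurable $c:P\to(0,\infty)$ with $0<c_-\le c(p)\le c_+<\infty$; a measurable $G:P\times\mathbb R^d\to[0,\infty)$ with $G(p,D_u^{\boldsymbol\beta}t)=uG(p,t)$ for all $p,t$, $u>0$ and, for some $0<g_-\le g_+<\infty$, $g_-\le G(p,t)\le g_+$ for all $p$ whenever $\rho_{\boldsymbol\beta}(t)=1$; a measurable $\mathcal R$ such that on $\mathsf A(p)\cap B_\varepsilon$ $$f(F(p,s))-f_0=c(p)G(p,s)(1+\mathcal R(p,s)),\qquad\mathcal R(p,0)=0,\qquad\lim_{r\downarrow0}\sup_{p\in P}\ \sup_{s\in\mathsf A(p),\,\rho_{\boldsymbol\beta}(s)\le r}|\mathcal R(p,s)|=0;$$ and sets $\mathsf A^\infty(p)\subset\mathbb R^d$ with measurable graph such that for every $0<\delta<1$ $$\sup_{p\in P}\int_{\mathbb R^d}\Bigl|\mathbf 1_{D_{zc(p)}^{\boldsymbol\beta}(\mathsf A(p)\cap B_\varepsilon)}(t)-\mathbf 1_{\mathsf A^\infty(p)}(t)\Bigr|e^{-(1-\delta)G(p,t)}\,dt\longrightarrow0\qquad(z\to\infty).$$ Let $\varepsilon$ be small enough that $|\mathcal R(p,s)|\le\delta_0<1$ throughout the coordinate domain. Let $b(p,s):=a(F(p,s))J(p,s)$ be bounded on the truncated cell graph $\{(p,s):p\in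 P,\ s\in\mathsf A(p)\cap B_\varepsilon\}$, and suppose there is a bounded measurable $b_0:P\to\mathbb C$ with $$\lim_{r\downarrow0}\sup_{p\in P}\ \sup_{s\in\mathsf A(p),\,\rho_{\boldsymbol\beta}(s)\le r}|b(p,s)-b_0(p)|=0 .$$ Define $\mathcal L(p):=b_0(p)\int_{\mathsf A^\infty(p)}e^{-G(p,t)}\,dt$. Then, as $z\to\infty$, $$\sup_{p\in P}\bigl|e^{zf_0}(zc(p))^Q\,\mathcal I(z,p)-\mathcal L(p)\bigr|\longrightarrow0 .$$ Equivalently, there are functions $r_z:P\to\mathbb C$ with $\sup_P|r_z|\to0$ such that $\mathcal I(z,p)=e^{-zf_0}z^{-Q}c(p)^{-Q}(\mathcal L(p)+r_z(p))$ (in particular this remains valid when $\mathcal L(p)=0$). If $\inf_{p\in P}|\mathcal L(p)|>0$, then $\mathcal I(z,p)\sim e^{-zf_0}(zc(p))^{-Q}\mathcal L(p)$ uniformly in $p\in P$.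
   Context: Setting. $(N,g)$ is a $C^2$ Riemannian manifold of dimension $n$ with Riemannian volume measure $\mathrm{dvol}_g$; $f:N\to\mathbb R$ is continuous and bounded below; $a:N\to\mathbb C$ is measurable; $f_0:=\inf_Nf$; $M:=\{x\in N:f(x)=f_0\}$ is nonempty and compact. $\mathcal T_\varepsilon(M):=\{x:\operatorname{dist}_g(x,M)<\varepsilon\}$; $B_r$ is the open Euclidean ball of radius $r$ at $0$. $M=\bigsqcup_{j=0}^{\ell}\Sigma_j$ is a disjoint union of finitely many $C^2$ embedded strata, $\Sigma_j$ a (possibly empty or disconnected) $j$-dimensional submanifold. Normal-cell decomposition. There are $\varepsilon>0$ and a finite index set $\mathcal A$, and for each $\alpha\in\mathcal A$: a Borel set $P_\alpha\subset\Sigma_{j_\alpha}$ of finite $j_\alpha$-dimensional Riemannian volume, with $M=\bigsqcup_\alpha P_\alpha$; an open neighborhood $U_\alpha$ of $P_\alpha$ in $\Sigma_{j_\alpha}$; $d_\alpha:=n-j_\alpha$; a $C^1$ map $F_\alpha:U_\alpha\times B_\varepsilon\to N$ with $F_\alpha(p,0)=p$; and sets (cells) $\mathsf A_\alpha(p)\subset\mathbb R^{d_\alpha}$, $p\in P_\alpha$, with measurable graph. With $\mathfrak D_\alpha(\varepsilon):=\{(p,s):p\in P_\alpha,\ s\in\mathsf A_\alpha(p)\cap B_\varepsilon\}$, the sets $F_\alpha(\mathfrak D_\alpha(\varepsilon))$ are pairwise disjoint up to null sets and cover $\mathcal T_\varepsilon(M)$ up to a null set, and there are measurable $J_\alpha:\mathfrak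 D_\alpha(\varepsilon)\to(0,\infty)$ such that for every nonnegative measurable $h$ $$\int_{F_\alpha(\mathfrak D_\alpha(\varepsilon))}h\,\mathrm{dvol}_g=\int_{P_\alpha}\int_{\mathsf A_\alpha(p)\cap B_\varepsilon}h(F_\alpha(p,s))J_\alpha(p,s)\,ds\,\mathrm{dvol}_{P_\alpha}(p).$$ For $z>0$ put $\mathcal I_\alpha(z,p):=\int_{\mathsf A_\alpha(p)\cap B_\varepsilon}a(F_\alpha(p,s))J_\alpha(p,s)e^{-zf(F_\alpha(p,s))}\,ds$. Dilations. $D_u^{\boldsymbol\beta}t:=(u^{\beta_1}t_1,\dots,u^{\beta_d}t_d)$ for $u>0$; $\rho_{\boldsymbol\beta}(0)=0$ and for $t\neq0$, $\rho_{\boldsymbol\beta}(t)$ is the unique $r>0$ with $|D_{1/r}^{\boldsymbol\beta}t|=1$. Suprema over an empty set are zero; $\mathbf 1_E$ is the indicator of $E$. *)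

(* Defs.v *)
From HB Require Import structures.
From mathcomp Require Import all_boot all_order all_algebra.
From mathcomp Require Import all_classical all_reals all_analysis.
From mathcomp Require Import measurable_realfun complex.

Set Implicit Arguments.
Unset Strict Implicit.
Unset Printing Implicit Defensive.

Import Order.TTheory GRing.Theory Num.Theory numFieldNormedType.Exports.

Local Open Scope classical_set_scope.
Local Open Scope ring_scope.

(* The sigma-algebra on row vectors is generated by the coordinates, hence it
   is the Borel sigma-algebra of R^n. *)
Definition measure_rV_display : measure_display.
Proof. exact (measure_tuple_display default_measure_display). Qed.

Section measurable_rV.
Context (R : realType) (n : nat).

Let coord_rV : 'I_n -> 'rV[R]_n -> R := fun i x => x 0 i.

Let rV_set0 : g_sigma_preimage coord_rV set0.
Proof. exact: sigma_algebra0. Qed.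

Let rV_setC A : g_sigma_preimage coord_rV A -> g_sigma_preimage coord_rV (~` A).
Proof. exact: sigma_algebraC. Qed.

Let rV_bigcup (F : (set 'rV[R]_n)^nat) :
  (forall i, g_sigma_preimage coord_rV (F i)) ->
  g_sigma_preimage coord_rV (\bigcup_i (F i)).
Proof. exact: sigma_algebra_bigcup. Qed.

HB.instance Definition _ := @isMeasurable.Build measure_rV_display
  'rV[R]_n (g_sigma_preimage coord_rV) rV_set0 rV_setC rV_bigcup.

Lemma measurable_coord_rV (i : 'I_n) :
  measurable_fun [set: 'rV[R]_n] (fun x : 'rV[R]_n => x 0 i).
Proof.
move=> _ Y mY; rewrite setTI; apply: sub_sigma_algebra => /=.
rewrite -bigcup_seq/=; exists i => /=; first by rewrite mem_index_enum.
by exists Y => //; rewrite setTI.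
Qed.

Lemma measurable_fun_rV d (T : measurableType d) (f : T -> 'rV[R]_n) :
  (forall i, measurable_fun [set: T] (fun x => f x 0 i)) ->
  measurable_fun [set: T] f.
Proof.
move=> mf.
apply: (@measurability _ _ _ _ _ _
  (\big[setU/set0]_(i < n) preimage_set_system setT (coord_rV i) measurable)).
  by [].
move=> A [B]; rewrite -bigcup_seq/= => -[i _ [C mC <-]] <-.
have := mf i measurableT C mC.
by rewrite !setTI.
Qed.

End measurable_rV.

(* Lebesgue measure on row vectors: the point mass on R^0, and on R^(n+1) the
   image of (Lebesgue measure on R) x (Lebesgue measure on R^n) under
   (a, v) |-> row_mx a v. *)
Section lebesgue_rV.
Local Open Scope ereal_scope.
Context (R : realType).

Section step.
Context (n : nat) (mu : {sigma_finite_measure set 'rV[R]_n -> \bar R}).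

Definition rV_cons (q : measurableTypeR R * 'rV[R]_n) : 'rV[R]_n.+1 :=
  row_mx (const_mx q.1 : 'rV[R]_1) q.2.

Lemma rV_cons_lshift q (k : 'I_1) : rV_cons q 0%R (lshift n k) = q.1.
Proof.
transitivity ((row_mx (const_mx q.1 : 'rV[R]_1) q.2) 0%R (lshift n k)) => //.
by rewrite row_mxEl mxE.
Qed.

Lemma rV_cons_rshift q (k : 'I_n) : rV_cons q 0%R (rshift 1 k) = q.2 0%R k.
Proof.
transitivity ((row_mx (const_mx q.1 : 'rV[R]_1) q.2) 0%R (rshift 1 k)) => //.
by rewrite row_mxEr.
Qed.

Lemma measurable_rV_cons : measurable_fun setT rV_cons.
Proof.
apply: measurable_fun_rV => i.
case: (@split_ordP 1 n i) => k ->.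
  under eq_fun do rewrite rV_cons_lshift.
  exact: measurable_fst.
under eq_fun do rewrite rV_cons_rshift.
apply: (@measurableT_comp _ _ _ _ _ _ (fun x : 'rV[R]_n => x 0%R k)) => //.
exact: measurable_coord_rV.
Qed.

Definition rV_uncons (x : 'rV[R]_n.+1) : measurableTypeR R * 'rV[R]_n :=
  (x 0%R (lshift n (ord0 : 'I_1)), @rsubmx R 1 1 n x).

Lemma rV_consK : cancel rV_cons rV_uncons.
Proof.
by move=> [a v]; congr pair; [rewrite rV_cons_lshift|exact: row_mxKr].
Qed.

Lemma measurable_rV_uncons : measurable_fun setT rV_uncons.
Proof.
apply: measurable_fun_pair; first exact: measurable_coord_rV.
apply: measurable_fun_rV => i.
rewrite (_ : (fun _ => _) =
  (fun x : 'rV[R]_n.+1 => x 0%R (rshift 1 i : 'I_(1 + n)))).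
  exact: measurable_coord_rV.
by apply/funext => x; rewrite mxE.
Qed.

Definition lebesgue_step (A : set 'rV[R]_n.+1) : \bar R :=
  (@lebesgue_measure R \x mu) (rV_cons @^-1` A).

Let step0 : lebesgue_step set0 = 0.
Proof. by rewrite /lebesgue_step preimage_set0 measure0. Qed.

Let step_ge0 A : 0 <= lebesgue_step A.
Proof. exact: measure_ge0. Qed.

Let step_sigma_additive : semi_sigma_additive lebesgue_step.
Proof.
have mpre A : measurable A -> measurable (rV_cons @^-1` A).
  by move=> mA; rewrite -[X in measurable X]setTI; exact: measurable_rV_cons.
move=> F mF tF mUF; rewrite /lebesgue_step preimage_bigcup.
apply: measure_semi_sigma_additive.
- by move=> i; exact: mpre.
- apply/trivIsetP => /= i j _ _ ij; rewrite -preimage_setI.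
  by move/trivIsetP : tF => /(_ _ _ _ _ ij) ->//; rewrite preimage_set0.
- by rewrite -preimage_bigcup; exact: mpre.
Qed.

HB.instance Definition _ := isMeasure.Build _ _ _
  lebesgue_step step0 step_ge0 step_sigma_additive.

Let step_sigma_finite : sigma_finite setT lebesgue_step.
Proof.
have /sigma_finiteP[F [FT ndF Foo]] := sigma_finiteT (@lebesgue_measure R).
have /sigma_finiteP[G [GT ndG Goo]] := sigma_finiteT mu.
exists (fun i => rV_uncons @^-1` (F i `*` G i)).
  rewrite -preimage_bigcup (_ : \bigcup_i _ = setT) ?preimage_setT//.
  apply/seteqP; split=> // -[x y] _.
  have [i _ Fx] : (\bigcup_i F i) x by rewrite -FT.
  have [k _ Gy] : (\bigcup_i G i) y by rewrite -GT.
  exists (maxn i k) => //; split.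
  - by move: x Fx; exact/subsetPset/ndF/leq_maxl.
  - by move: y Gy; exact/subsetPset/ndG/leq_maxr.
move=> i; have [mF Fi] := Foo i; have [mG Gi] := Goo i; split.
  rewrite -[X in measurable X]setTI; apply: measurable_rV_uncons => //.
  exact: measurableX.
rewrite /lebesgue_step -comp_preimage (_ : _ \o _ = id) ?preimage_id.
  by rewrite product_measure1E// lte_mul_pinfty// ge0_fin_numE.
by apply/funext => q; exact: rV_consK.
Qed.

HB.instance Definition _ := Measure_isSigmaFinite.Build _ _ _
  lebesgue_step step_sigma_finite.

End step.

Fixpoint lebesgue_rV (n : nat) : {sigma_finite_measure set 'rV[R]_n -> \bar R} :=
  match n with
  | 0 => [the {sigma_finite_measure set 'rV[R]_0 -> \bar R} of
            \d_(0%R : 'rV[R]_0)]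
  | m.+1 => [the {sigma_finite_measure set 'rV[R]_m.+1 -> \bar R} of
             lebesgue_step (lebesgue_rV m)]
  end.

End lebesgue_rV.

Section euclidean.
Context (R : realType).

Definition enorm n (v : 'rV[R]_n) : R := Num.sqrt (\sum_i v 0 i ^+ 2).

Definition eball n (r : R) : set 'rV[R]_n := [set s | enorm s < r].

(* C^k on an open set of a finite-dimensional space, by iterating Frechet
   differentiability and directional derivatives. *)
Fixpoint Ck (V W : normedModType R) (k : nat) (O : set V) (f : V -> W) : Prop :=
  match k with
  | 0 => forall x, O x -> {for x, continuous f}
  | m.+1 => (forall x, O x -> differentiable f x) /\
            forall v, Ck m O (fun x => 'D_v f x)
  end.

(* Supremum of a nonnegative function, with value 0 on the empty set. *)
Definition supr0 (T : Type) (S : set T) (h : T -> \bar R) : \bar R :=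
  ereal_sup ([set 0%E] `|` [set h x | x in S]).

End euclidean.

Section complex_valued.
Context (R : realType).

Definition cmeasurable_fun d (T : measurableType d) (D : set T)
    (h : T -> R[i]) : Prop :=
  measurable_fun D (fun x => complex.Re (h x)) /\
  measurable_fun D (fun x => complex.Im (h x)).

Definition cintegral d (T : measurableType d) (mu : {measure set T -> \bar R})
    (D : set T) (h : T -> R[i]) : R[i] :=
  Complex (\int[mu]_(x in D) complex.Re (h x))
          (\int[mu]_(x in D) complex.Im (h x)).

End complex_valued.

Notation normc := ComplexField.Normc.normc.

(* The Borel sigma-algebra of a topological space. *)
Notation borel N := (g_sigma_algebraType (@open N)).

Section charts.
Context (R : realType) (N : ptopologicalType) (n : nat).

(* [coord] is only meaningful on [dom], and [param] on [codom]. *)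
Record chart := Chart {
  dom : set N;
  coord : N -> 'rV[R]_n;
  param : 'rV[R]_n -> N
}.

Definition codom (c : chart) : set 'rV[R]_n := coord c @` dom c.

Definition is_chart (c : chart) : Prop :=
  [/\ open (dom c), open (codom c),
      (forall x, dom c x -> param c (coord c x) = x),
      (forall x, dom c x -> {for x, continuous (coord c)}) &
      (forall u, codom c u -> {for u, continuous (param c)})].

Definition transition (c c' : chart) : 'rV[R]_n -> 'rV[R]_n :=
  coord c' \o param c.

Definition C2_compatible (c c' : chart) : Prop :=
  Ck 2 (coord c @` (dom c `&` dom c')) (transition c c') /\
  Ck 2 (coord c' @` (dom c `&` dom c')) (transition c' c).

End charts.

(* A C^2 manifold (with its maximal atlas) carrying a Riemannian metric, given
   by its Gram matrices in the charts. These are C^1, the highest regularity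
   that is preserved by C^2 changes of coordinates. *)
Record riemannian_manifold (R : realType) (n : nat) := RiemannianManifold {
  carrier :> ptopologicalType;
  carrier_hausdorff : hausdorff_space carrier;
  carrier_second_countable : @second_countable carrier;
  atlas : set (chart R carrier n);
  atlas_chart : forall c, atlas c -> is_chart c;
  atlas_cover : forall x, exists2 c, atlas c & dom c x;
  atlas_compatible : forall c c', atlas c -> atlas c' -> C2_compatible c c';
  atlas_maximal : forall c, is_chart c ->
    (forall c', atlas c' -> C2_compatible c c') -> atlas c;
  metric : chart R carrier n -> 'rV[R]_n -> 'M[R]_n;
  metric_sym : forall c u, atlas c -> codom c u ->
    (metric c u)^T = metric c u;
  metric_pos : forall c u (v : 'rV[R]_n), atlas c -> codom c u -> v != 0 ->
    0 < (v *m metric c u *m v^T) 0 0;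
  metric_C1 : forall c, atlas c -> Ck 1 (codom c) (metric c);
  metric_change : forall c c' x, atlas c -> atlas c' -> dom c x -> dom c' x ->
    let J := jacobian (transition c c') (coord c x) in
    metric c (coord c x) = J *m metric c' (coord c' x) *m J^T
}.

Section riemannian.
Context (R : realType) (n : nat) (N : riemannian_manifold R n).

Definition curve_length (c : chart R N n) (g : R -> 'rV[R]_n) : R :=
  \int[@lebesgue_measure R]_(t in `[0, 1])
    Num.sqrt ((derive1 g t *m metric c (g t) *m (derive1 g t)^T) 0 0).

(* Lengths of the piecewise C^1 curves from a point to another, subdivided so
   that each C^1 piece is contained in the domain of a chart. *)
Inductive path_length : N -> N -> R -> Prop :=
| path_length_nil x : path_length x x 0
| path_length_cons (c : chart R N n) (g : R -> 'rV[R]_n) x y z l :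
    atlas c -> dom c x -> dom c y ->
    Ck 1 setT (g : R^o -> 'rV[R]_n) ->
    (forall t, `[0, 1]%classic t -> codom c (g t)) ->
    g 0 = coord c x -> g 1 = coord c y ->
    path_length y z l -> path_length x z (curve_length c g + l).

Definition rdist (x y : N) : \bar R :=
  ereal_inf [set l%:E | l in path_length x y].

Definition tube (eps : R) (M : set N) : set N :=
  [set x | (ereal_inf [set rdist x y | y in M] < eps%:E)%E].

(* R^j x 0 in R^n; [pid_mx j] is the j x n matrix of the inclusion. *)
Definition pad (j : nat) (u : 'rV[R]_j) : 'rV[R]_n :=
  u *m (pid_mx j : 'M[R]_(j, n)).

Definition slice_chart (j : nat) (S : set N) (c : chart R N n) : Prop :=
  atlas c /\ coord c @` (dom c `&` S) = codom c `&` range (@pad j).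

Definition embedded_submanifold (j : nat) (S : set N) : Prop :=
  forall x, S x -> (j <= n)%N /\ exists2 c, slice_chart j S c & dom c x.

(* [mu] restricts on S to the volume of the induced metric: in a slice chart,
   its density is the square root of the Gram determinant of the first j
   coordinate vectors. For j = n and S = setT this is dvol_g. *)
Definition riemannian_volume (j : nat) (S : set N)
    (mu : {measure set (borel N) -> \bar R}) : Prop :=
  forall c (B : set (borel N)), slice_chart j S c -> measurable B ->
    B `<=` dom c `&` S ->
    mu B = (\int[@lebesgue_rV R j]_(u in [set u | (coord c @` B) (pad u)])
      (Num.sqrt (\det ((pid_mx j : 'M[R]_(j, n)) *m metric c (pad u) *m
                       (pid_mx j : 'M[R]_(j, n))^T)))%:E)%E.

(* F is of class C^1 on U x B_eps, read in slice charts of the j-dimensional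
   submanifold S (for its points p) and in charts of N (for the values). *)
Definition C1_on_product (j d : nat) (S U : set N) (eps : R)
    (F : N -> 'rV[R]_d -> N) : Prop :=
  forall c c', slice_chart j S c -> atlas c' ->
    let O := [set q : 'rV[R]_j * 'rV[R]_d |
                [/\ codom c (pad q.1), U (param c (pad q.1)), eball eps q.2 &
                    dom c' (F (param c (pad q.1)) q.2)]] in
    open O /\ Ck 1 O (fun q => coord c' (F (param c (pad q.1)) q.2)).

End riemannian.

(* The data of a normal-cell decomposition: [radius] is epsilon and, for each
   piece k (of dimension [sdim k]), [base k] is P, [bnbhd k] is U, [nmap k] is F,
   [cell k p] is A(p) and [jac k] is J. The maps are total; only their values on
   the domains of the mathematical objects are constrained. *)
Record normal_cell_data (R : realType) (n : nat) (N : riemannian_manifold R n)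
    (l : nat) := NormalCellData {
  radius : R;
  piece : finType;
  sdim : piece -> 'I_l.+1;
  base : piece -> set (borel N);
  bnbhd : piece -> set N;
  nmap : forall k : piece, N -> 'rV[R]_(n - sdim k) -> N;
  cell : forall k : piece, N -> set 'rV[R]_(n - sdim k);
  jac : forall k : piece, N -> 'rV[R]_(n - sdim k) -> R
}.

Arguments nmap {R n N l} _ k _ _.
Arguments cell {R n N l} _ k _ _.
Arguments jac {R n N l} _ k _ _.

Section normal_cells.
Local Unset Implicit Arguments.
Context (R : realType) (n : nat) (N : riemannian_manifold R n) (l : nat)
  (D : normal_cell_data N l).

Definition codim (k : piece D) : nat := (n - sdim k)%N.

Definition tcell (k : piece D) (p : N) : set 'rV[R]_(codim k) :=
  cell D k p `&` @eball R _ (radius D).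

Definition tgraph (k : piece D) : set (borel N * 'rV[R]_(codim k)) :=
  [set q | base k q.1 /\ tcell k q.1 q.2].

Definition timage (k : piece D) : set (borel N) :=
  [set nmap D k q.1 q.2 | q in tgraph k].

Record normal_cells (vol : {measure set (borel N) -> \bar R})
    (S : 'I_l.+1 -> set N)
    (svol : 'I_l.+1 -> {measure set (borel N) -> \bar R}) (M : set N) : Prop :=
NormalCells {
  radius_gt0 : 0 < radius D;
  base_measurable : forall k : piece D, measurable (base k);
  base_stratum : forall k : piece D, base k `<=` S (sdim k);
  base_finite : forall k : piece D, (svol (sdim k) (base k) < +oo)%E;
  base_disjoint : trivIset setT (@base _ _ _ _ D);
  base_cover : \bigcup_(k in [set: piece D]) base k = M;
  bnbhd_open : forall k : piece D,
    exists2 W : set N, open W & bnbhd k = W `&` S (sdim k);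
  base_bnbhd : forall k : piece D, base k `<=` bnbhd k;
  nmap_C1 : forall k : piece D,
    C1_on_product (sdim k) (S (sdim k)) (bnbhd k) (radius D) (nmap D k);
  nmap0 : forall (k : piece D) p, bnbhd k p -> nmap D k p 0 = p;
  cell_measurable : forall k : piece D, measurable
    ([set q | base k q.1 /\ cell D k q.1 q.2] :
      set (borel N * 'rV[R]_(codim k)));
  timage_disjoint : forall k k' : piece D, k != k' ->
    vol.-negligible (timage k `&` timage k');
  timage_cover : vol.-negligible
    (tube (radius D) M `\` \bigcup_(k in [set: piece D]) timage k);
  jac_measurable : forall k : piece D,
    measurable_fun (tgraph k) (fun q => jac D k q.1 q.2);
  jac_gt0 : forall (k : piece D) q, tgraph k q -> 0 < jac D k q.1 q.2;
  change_of_variables : forall (k : piece D) (h : borel N -> \bar R),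
    measurable_fun setT h -> (forall x, (0 <= h x)%E) ->
    (\int[vol]_(x in timage k) h x =
     \int[svol (sdim k)]_(p in base k)
       \int[@lebesgue_rV R (codim k)]_(s in tcell k p)
         (h (nmap D k p s) * (jac D k p s)%:E))%E
}.

Definition cell_integral (f : N -> R) (a : N -> R[i]) (k : piece D) (z : R)
    (p : N) : R[i] :=
  cintegral (@lebesgue_rV R (codim k)) (tcell k p)
    (fun s => a (nmap D k p s) *
              (jac D k p s)%:C%C * (expR (- z * f (nmap D k p s)))%:C%C).

End normal_cells.

Arguments normal_cells {R n N l} D vol S svol M.
Arguments codim {R n N l} D k.
Arguments tcell {R n N l} D k p.
Arguments tgraph {R n N l} D k.
Arguments timage {R n N l} D k.
Arguments cell_integral {R n N l} D f a k z p.

Section dilations.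
Context (R : realType) (d : nat) (beta : 'I_d -> R).

Definition dil (u : R) (t : 'rV[R]_d) : 'rV[R]_d :=
  \row_i (u `^ beta i * t 0 i).

(* For t != 0 and beta > 0 the set below is a singleton. *)
Definition rho (t : 'rV[R]_d) : R :=
  if t == 0 then 0 else xget 0 [set r | 0 < r /\ enorm (dil r^-1 t) = 1].

End dilations.

(* Main.v *)
(* Substituting s = D_{1/u} t with u = z c(p) turns e^(z f0) u^Q I(z, p) into
   the integral of b(p, s) e^(- G(p, t) (1 + R(p, s))) over the dilated cell, by
   homogeneity of G. Since G >= g_- rho, the integrands are dominated by
   e^(- kappa rho(t)), which is integrable because rho(t) >= |t_i|^(1 / beta_i).
   Where rho(s) <= r, i.e. rho(t) <= r u, replacing b by b0 and R by 0 costs a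
   small multiple of this majorant. Where rho(t) > r u, half of the exponential
   decay gives a factor e^(- kappa r u). Replacing the dilated cell by its limit
   is controlled by the hypothesis of cell convergence. All these bounds are
   uniform in p. *)
Require Import Defs.
From HB Require Import structures.
From mathcomp Require Import all_boot all_order all_algebra.
From mathcomp Require Import all_classical all_reals all_analysis.
From mathcomp Require Import measurable_realfun complex.
From mathcomp Require Import ring lra.
Import Order.TTheory GRing.Theory Num.Theory numFieldNormedType.Exports.
Local Open Scope classical_set_scope.
Local Open Scope ring_scope.

(** * Integration on row vectors *)

Section integration_rV.
Context {R : realType}.
Local Open Scope ereal_scope.

(** Let 1 - th bound the remainder. The decay e^(-th G) is spent in instalments: half of it absorbs
    the factor G that appears when the remainder is removed from the exponent, and half of what is
    left pays for the region far from the origin. Hence the rate kappa = th g / 4 of the majorant.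
    Complex amplitudes enter through their real and imaginary parts, so the analysis is real-valued.
    A real integral is the [fine] part of an extended one, hence linearity requires integrability;
    it is obtained in the dilated variable t, where the majorant lives, and carried back to s.
    Lebesgue measure on row vectors is built one coordinate at a time, so both the Jacobian u^Q of a
    dilation and the integrability of the majorant are proved by induction on the dimension. The
    sigma-algebra is generated by the coordinates, whereas F(p, .) is regular only when read in
    charts; measurability of the integrand therefore goes through open sets. *)

Lemma preimage_ocitv_scale (c a b : R) : (0 < c)%R ->
  ( *%R c) @^-1` `]a, b] = `](a / c)%R, (b / c)%R]%classic.
Proof.
move=> c0; apply/seteqP; split=> x /=; rewrite !in_itv/=;
  by rewrite ltr_pdivrMr// ler_pdivlMr// (mulrC x).
Qed.

(** By uniqueness of Lebesgue measure: the left side is a measure in [A] that has the right value on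
    half-open intervals. *)
Lemma lebesgue_measure_scale (c : R) (A : set (measurableTypeR R)) :
  (0 < c)%R -> measurable A ->
  c%:E * lebesgue_measure (( *%R c : measurableTypeR R -> measurableTypeR R) @^-1` A)
  = lebesgue_measure A.
Proof.
move=> c0 mA.
have mc : measurable_fun setT ( *%R c : measurableTypeR R -> measurableTypeR R).
  exact: measurable_funM.
pose c' := NngNum (ltW c0).
pose mu : {measure set (measurableTypeR R) -> \bar R} :=
  mscale c' (pushforward lebesgue_measure ( *%R c : measurableTypeR R -> measurableTypeR R)).
rewrite -[LHS]/(mu mc A); apply/esym/lebesgue_measure_unique => // _ [[a b]] _ <- /=.
rewrite /mscale/= /pushforward preimage_ocitv_scale// !lebesgue_measure_itv/= !lte_fin.
rewrite ltr_pM2r ?invr_gt0//; case: ifP => _; last by rewrite mule0.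
rewrite -!EFinD -EFinM -mulrBl mulrCA divff ?mulr1//.
by rewrite gt_eqF.
Qed.

Lemma ge0_integral_scale (c : R) (h : measurableTypeR R -> \bar R) :
  (0 < c)%R -> measurable_fun setT h -> (forall x, 0 <= h x) ->
  c%:E * \int[lebesgue_measure]_x h (c * x)%R = \int[lebesgue_measure]_x h x.
Proof.
move=> c0 mh h0.
have mc : measurable_fun setT ( *%R c : measurableTypeR R -> measurableTypeR R).
  exact: measurable_funM.
rewrite -(@ge0_integral_pushforward _ _ _ _ _ _ mc lebesgue_measure setT)//.
have c'0 := ltW c0.
rewrite -(@ge0_integral_mscale _ _ _ _ setT _ (NngNum c'0))//.
apply: eq_measure_integral => //= A mA _; rewrite /mscale/= /pushforward.
exact: lebesgue_measure_scale.
Qed.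

(** The measure in dimension n+1 is by construction the image of a product measure under [rV_cons],
    so this is a pushforward followed by Tonelli. *)
Lemma ge0_integral_rV_cons {n} (h : 'rV[R]_n.+1 -> \bar R) :
  measurable_fun setT h -> (forall x, 0 <= h x) ->
  \int[lebesgue_rV R n.+1]_x h x =
  \int[lebesgue_measure]_a \int[lebesgue_rV R n]_v h (rV_cons (a, v)).
Proof.
move=> mh h0.
have mhc : measurable_fun setT (h \o @rV_cons R n).
  by apply: measurableT_comp => //; exact: measurable_rV_cons.
rewrite -(@fubini_tonelli1 _ _ _ _ _ lebesgue_measure (lebesgue_rV R n)
  (h \o @rV_cons R n))//; last by move=> x; exact: h0.
rewrite -[setT in RHS](preimage_setT (@rV_cons R n)).
rewrite -(ge0_integral_pushforward (@measurable_rV_cons R n) _ measurableT mh)//.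
Qed.

(** Arbitrary weights instead of u^(beta_i), so that an induction on the dimension can drop the
    first one; [dil beta u] is the case w_i = u^(beta_i). *)
Definition row_scale {n} (w : 'I_n -> R) (t : 'rV[R]_n) : 'rV[R]_n :=
  \row_i (w i * t 0%R i)%R.

Lemma measurable_row_scale {n} (w : 'I_n -> R) : measurable_fun setT (row_scale w).
Proof.
apply: measurable_fun_rV => i; under eq_fun do rewrite mxE.
by apply: measurable_funM => //; exact: measurable_coord_rV.
Qed.

Lemma row_scale_cons n (w : 'I_n.+1 -> R) a v :
  row_scale w (rV_cons (a, v)) =
  rV_cons ((w ord0 * a)%R, row_scale (w \o @lift n.+1 ord0) v).
Proof.
apply/rowP => i; rewrite mxE; case: (@split_ordP 1 n i) => k ->.
  by rewrite !rV_cons_lshift/= ord1; congr (w _ * _)%R; apply: val_inj.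
rewrite !rV_cons_rshift/= mxE/=; congr (w _ * _)%R; exact: val_inj.
Qed.

(** Induction on [n]: the outer variable is rescaled by the one-dimensional formula, and the
    induction hypothesis handles the remaining ones at each fixed value of the first. *)
Lemma ge0_integral_row_scale {n} (w : 'I_n -> R) (h : 'rV[R]_n -> \bar R) :
  (forall i, 0 < w i)%R -> measurable_fun setT h -> (forall x, 0 <= h x) ->
  (\prod_i w i)%:E * \int[lebesgue_rV R n]_t h (row_scale w t) =
  \int[lebesgue_rV R n]_t h t.
Proof.
elim: n w h => [|n IH] w h w0 mh h0.
  rewrite big_ord0 mul1e; apply: eq_integral => x _; congr h.
  by apply/rowP => -[].
have mhw : measurable_fun setT (h \o row_scale w).
  by apply: measurableT_comp => //; exact: measurable_row_scale.
rewrite (ge0_integral_rV_cons (h \o row_scale w))//; last by move=> x; exact: h0.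
rewrite (ge0_integral_rV_cons h)//.
have mhc : measurable_fun setT (h \o @rV_cons R n).
  by apply: measurableT_comp => //; exact: measurable_rV_cons.
rewrite -[RHS](ge0_integral_scale (w ord0))//; last 2 first.
- exact: (@measurable_fun_fubini_tonelli_F _ _ _ _ R (lebesgue_rV R n)
    (h \o @rV_cons R n) mhc (fun x => h0 _)).
- by move=> x; apply: integral_ge0.
rewrite big_ord_recl EFinM -muleA; congr (_ * _).
have mhwc : measurable_fun setT (h \o row_scale w \o @rV_cons R n).
  by apply: measurableT_comp => //; exact: measurable_rV_cons.
have p0 : (0 <= \prod_(i < n) w (lift ord0 i))%R by apply: prodr_ge0 => i _; exact: ltW.
rewrite -ge0_integralZl//; last 2 first.
- exact: (@measurable_fun_fubini_tonelli_F _ _ _ _ R (lebesgue_rV R n)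
    (h \o row_scale w \o @rV_cons R n) mhwc (fun x => h0 _)).
- by move=> x _; apply: integral_ge0 => v _; exact: h0.
apply: eq_integral => a _.
rewrite -(IH (w \o @lift n.+1 ord0) (fun v => h (rV_cons ((w ord0 * a)%R, v))))//=.
- by congr (_ * _); apply: eq_integral => v _ /=; rewrite row_scale_cons.
- by apply: (measurableT_comp mhc); exact: pair1_measurable.
Qed.

End integration_rV.

(** * Integrability of products of stretched exponentials *)

Section decay.
Context {R : realType}.
Local Open Scope ereal_scope.

(** By evenness, twice the arctangent integral over the half-line. The function 1/(1 + x^2) serves
    below as the one-dimensional integrable majorant. *)
Lemma integral_oneDsqr_lty :
  \int[@lebesgue_measure R]_x ((oneDsqr x)^-1)%:E < +oo.
Proof.
rewrite ge0_symfun_integralT; last 3 first.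
- by move=> x; rewrite invr_ge0.
- exact: continuous_oneDsqrV.
- by move=> x /=; rewrite /oneDsqr sqrrN.
rewrite (_ : [set x : R | (0 <= x)%R] = `[0%R, +oo[%classic); last first.
  by apply/seteqP; split=> x /=; rewrite in_itv/= andbT.
by rewrite integral0y_oneDsqr -EFinM ltry.
Qed.

Lemma measurable_expR_powR (k g : R) :
  measurable_fun setT (fun x : R => expR (- k * `|x| `^ g)%R).
Proof.
apply: measurableT_comp => //; apply: measurable_funM => //.
exact: (measurableT_comp (measurable_powR _)).
Qed.

(** One term of the exponential series suffices: e^y >= 1 + y^(m+1)/(m+1)! with y = k |x|^g and m so
    large that g (m+1) >= 2. *)
Lemma expR_powR_le (k g : R) : (0 < k -> 0 < g ->
  exists2 C : R, 0 < C & forall x, expR (- k * `|x| `^ g) <= C * (oneDsqr x)^-1)%R.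
Proof.
move=> k0 g0.
have [m mg] : exists m : nat, (2 <= g * m.+1%:R)%R.
  exists (Num.truncn (2 / g)); rewrite mulrC -ler_pdivrMr//.
  by apply: ltW; exact: truncnS_gt.
pose c : R := (k ^+ m.+1 / m.+1`!%:R)%R.
have c0 : (0 < c)%R by rewrite divr_gt0// ?exprn_gt0// ltr0n fact_gt0.
have h3 : (0 < 2 / c)%R by rewrite divr_gt0.
have d0 : (0 < 2 + 2 / c)%R by rewrite addr_gt0.
(* The summand 2 covers |x| <= 1, where 1 + x^2 <= 2. For |x| > 1 the product (1 + c y)(2 + 2/c)
   contains c y (2/c) = 2 y, where now y = |x|^(g (m+1)) >= x^2. *)
exists (2 + 2 / c)%R => // x.
have y0 : (0 <= k * `|x| `^ g)%R by rewrite mulr_ge0 ?powR_ge0// ltW.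
rewrite mulNr expRN ler_pdivlMr; last by rewrite (lt_le_trans ltr01)// oneDsqr_ge1.
rewrite mulrC ler_pdivrMr ?expR_gt0// mulrC.
apply: le_trans (ler_wpM2r (ltW d0) (expR_ge1Dxn m y0)).
have -> : ((k * `|x| `^ g) ^+ m.+1 / m.+1`!%:R = c * `|x| `^ (g * m.+1%:R))%R.
  by rewrite exprMn powRrM powR_mulrn ?powR_ge0// /c mulrAC.
have h2 : (c * (2 / c) = 2)%R by rewrite mulrCA divff ?mulr1// gt_eqF.
rewrite /oneDsqr -real_normK ?num_real//.
have [x1|x1] := leP `|x|%R 1%R.
  have h1 : (`|x| ^+ 2 <= 1)%R by rewrite exprn_ile1.
  have h4 : (0 <= c * `|x| `^ (g * m.+1%:R))%R by rewrite mulr_ge0 ?powR_ge0// ltW.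
  apply: (@le_trans _ _ (1 * (2 + 2 / c))%R); first by lra.
  by apply: ler_wpM2r; lra.
have h1 : (`|x| ^+ 2 <= `|x| `^ (g * m.+1%:R))%R.
  by rewrite -powR_mulrn//; apply: ler_powR => //; exact: ltW.
set y := (`|x| `^ _)%R in h1 *.
have h5 : (1 <= `|x| ^+ 2)%R by rewrite exprn_ege1// ltW.
have cy : (0 < c * y)%R by rewrite mulr_gt0//; lra.
have -> : ((1 + c * y) * (2 + 2 / c) = 2 + 2 / c + c * y * 2 + y * (c * (2 / c)))%R by ring.
by rewrite h2; lra.
Qed.

Lemma integral_expR_powR_lty (k g : R) : (0 < k)%R -> (0 < g)%R ->
  \int[@lebesgue_measure R]_x (expR (- k * `|x| `^ g)%R)%:E < +oo.
Proof.
move=> k0 g0; have [C C0 hC] := expR_powR_le k g k0 g0.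
have mo : measurable_fun setT (fun x : R => ((oneDsqr x)^-1)%:E).
  by apply/measurable_EFinP; apply: continuous_measurable_fun; exact: continuous_oneDsqrV.
apply: (@le_lt_trans _ _ (\int[@lebesgue_measure R]_x (C%:E * ((oneDsqr x)^-1)%:E))).
  apply: ge0_le_integral => //.
  - by apply/measurable_EFinP; exact: measurable_expR_powR.
  - exact: emeasurable_funM.
  - by move=> x _; rewrite -EFinM lee_fin.
rewrite ge0_integralZl ?lee_fin ?(ltW C0)//.
by rewrite lte_mul_pinfty ?lee_fin ?(ltW C0)//; exact: integral_oneDsqr_lty.
Qed.

Lemma measurable_prod_rV {n} (h : 'I_n -> R -> R) :
  (forall i, measurable_fun setT (h i)) ->
  measurable_fun setT (fun t : 'rV[R]_n => \prod_i h i (t 0%R i))%R.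
Proof.
move=> mh; apply: measurable_prod => i _.
by apply: (measurableT_comp (mh i)); exact: measurable_coord_rV.
Qed.

(** By Tonelli the integral factorises, one coordinate per induction step. In dimension 0 the empty
    product 1 is integrated against a point mass. *)
Lemma integral_prod_rV_lty {n} (h : 'I_n -> R -> R) :
  (forall i, measurable_fun setT (h i)) -> (forall i x, 0 <= h i x)%R ->
  (forall i, \int[lebesgue_measure]_x (h i x)%:E < +oo) ->
  \int[lebesgue_rV R n]_t (\prod_i h i (t 0%R i))%:E < +oo.
Proof.
elim: n h => [|n IH] h mh h0 hoo.
  under eq_integral do rewrite big_ord0.
  by rewrite integral_cst// mul1e /= diracT ltry.
have mp := measurable_prod_rV h mh.
rewrite ge0_integral_rV_cons; last 2 first.
- exact/measurable_EFinP.
- by move=> t; rewrite lee_fin prodr_ge0.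
pose c := \int[lebesgue_rV R n]_t (\prod_i h (lift ord0 i) (t 0%R i))%:E.
have coo : c < +oo.
  by apply: (IH (fun i => h (lift ord0 i))) => i *; [exact: mh|exact: h0|exact: hoo].
have c0 : 0 <= c by apply: integral_ge0 => t _; rewrite lee_fin prodr_ge0.
have mp' : measurable_fun setT (fun t : 'rV[R]_n => \prod_i h (lift ord0 i) (t 0%R i))%R.
  exact: (measurable_prod_rV (fun i => h (lift ord0 i)) (fun i => mh _)).
under eq_integral => a _.
  rewrite (_ : \int[_]_v _ = (h ord0 a)%:E * c); last first.
    rewrite /c -ge0_integralZl//.
    - apply: eq_integral => v _; rewrite -EFinM big_ord_recl; congr ((_ * _)%:E).
        congr (h _ _); rewrite -[RHS](rV_cons_lshift (a, v) ord0).
        by congr (rV_cons _ _ _); exact: val_inj.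
      apply: eq_bigr => i _; congr (h _ _); rewrite -[RHS](rV_cons_rshift (a, v) i).
      by congr (rV_cons _ _ _); exact: val_inj.
    - exact/measurable_EFinP.
    - by move=> t _; rewrite lee_fin prodr_ge0.
    - by rewrite lee_fin.
  over.
rewrite ge0_integralZr//; last 2 first.
- by apply/measurable_EFinP; exact: mh.
- by move=> x _; rewrite lee_fin.
rewrite lte_mul_pinfty//; first by apply: integral_ge0 => x _; rewrite lee_fin.
by rewrite ge0_fin_numE//; apply: integral_ge0 => x _; rewrite lee_fin.
Qed.

End decay.

(** * Anisotropic dilations *)

Lemma cvg_sumr {R : realType} {T : Type} {F : set_system T} {FF : Filter F} {n}
    (f : 'I_n -> T -> R) (l : 'I_n -> R) :
  (forall i, f i @ F --> l i) -> (fun x => \sum_i f i x) @ F --> \sum_i l i.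
Proof.
elim: n f l => [|n IH] f l fl.
  by rewrite big_ord0; under eq_fun do rewrite big_ord0; exact: cvg_cst.
rewrite big_ord_recl; under eq_fun do rewrite big_ord_recl.
by apply: cvgD; [exact: fl|apply: (IH (fun i => f (lift ord0 i))) => i; exact: fl].
Qed.

Section rho.
Context {R : realType} {d : nat} (beta : 'I_d -> R).
Hypothesis beta0 : forall i, 0 < beta i.

Lemma dilE u t i : dil beta u t 0 i = u `^ beta i * t 0 i.
Proof. by rewrite mxE. Qed.

Lemma dil1 t : dil beta 1 t = t.
Proof. by apply/rowP => i; rewrite dilE powR1 mul1r. Qed.

Lemma dilM u v t : 0 < u -> 0 < v -> dil beta (u * v) t = dil beta u (dil beta v t).
Proof.
by move=> u0 v0; apply/rowP => i; rewrite !dilE powRM ?ltW// mulrA.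
Qed.

Lemma dilVK u : 0 < u -> cancel (dil beta u) (dil beta u^-1).
Proof.
by move=> u0 t; rewrite -dilM ?invr_gt0// mulVf ?gt_eqF// dil1.
Qed.

Lemma dilKV u : 0 < u -> cancel (dil beta u^-1) (dil beta u).
Proof.
by move=> u0 t; rewrite -dilM ?invr_gt0// mulfV ?gt_eqF// dil1.
Qed.

Lemma dil_eq0 u t : 0 < u -> (dil beta u t == 0) = (t == 0).
Proof.
have dil0 v : dil beta v 0 = 0 by apply/rowP => i; rewrite dilE !mxE mulr0.
move=> u0; apply/eqP/eqP => [h|->]; last exact: dil0.
by rewrite -(dilVK u u0 t) h dil0.
Qed.

Lemma rV_neq0_exists (t : 'rV[R]_d) : t != 0 -> exists i, t 0 i != 0.
Proof.
move=> t0; apply/existsP; apply: contraNT t0; rewrite negb_exists => /forallP h.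
by apply/eqP/rowP => i; rewrite mxE; have := h i; rewrite negbK => /eqP.
Qed.

(** Every coordinate grows weakly in modulus with the parameter, and a nonzero one strictly. This
    monotonicity makes the radius in the definition of [rho] unique. *)
Lemma enorm_dil_ltr {u v t} : t != 0 -> 0 < u -> u < v ->
  enorm (dil beta u t) < enorm (dil beta v t).
Proof.
move=> t0 u0 uv; have v0 := lt_trans u0 uv.
have [i ti] := rV_neq0_exists t t0.
have le1 j : (dil beta u t 0 j) ^+ 2 <= (dil beta v t 0 j) ^+ 2.
  rewrite !dilE !exprMn ler_wpM2r ?sqr_ge0// lerXn2r ?nnegrE ?powR_ge0//.
  by rewrite ge0_ler_powR ?nnegrE// ltW.
have lt1 : (dil beta u t 0 i) ^+ 2 < (dil beta v t 0 i) ^+ 2.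
  rewrite !dilE !exprMn ltr_pM2r; last by rewrite exprn_even_gt0.
  by rewrite ltrXn2r ?nnegrE ?powR_ge0// gt0_ltr_powR ?nnegrE// ltW.
have s0 : 0 < \sum_i (dil beta v t 0 i) ^+ 2.
  rewrite (bigD1 i)//= ltr_pwDl//; first exact: le_lt_trans (sqr_ge0 _) lt1.
  by apply: sumr_ge0 => j _; exact: sqr_ge0.
by rewrite /enorm ltr_sqrt// (bigD1 i)//= [ltRHS](bigD1 i)//= ltr_leD// ler_sum.
Qed.

Lemma enorm_dil_inj t u v : t != 0 -> 0 < u -> 0 < v ->
  enorm (dil beta u t) = enorm (dil beta v t) -> u = v.
Proof.
move=> t0 u0 v0 e; apply/eqP; rewrite eq_le; apply/andP; split; rewrite leNgt; apply/negP => h.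
  by have := enorm_dil_ltr t0 v0 h; rewrite e ltxx.
by have := enorm_dil_ltr t0 u0 h; rewrite e ltxx.
Qed.

Lemma continuous_powR (b x : R) : 0 < x -> {for x, continuous (fun y : R => y `^ b)}.
Proof.
move=> x0; apply: differentiable_continuous; apply/derivable1_diffP.
by apply: derivable_powR; rewrite in_itv/= x0.
Qed.

(** Intermediate value theorem for the squared norm [f] of the dilated vector on [0, m]. *)
Lemma dil_enorm1_exists t : t != 0 ->
  exists2 r, 0 < r & enorm (dil beta r t) = 1.
Proof.
move=> t0.
pose f (r : R) := \sum_i (r `^ beta i) ^+ 2 * (t 0 i) ^+ 2.
have fE r : enorm (dil beta r t) = Num.sqrt (f r).
  by congr Num.sqrt; apply: eq_bigr => i _; rewrite dilE exprMn.
have f0 : f 0 = 0.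
  by rewrite /f big1// => i _; rewrite powR0 ?gt_eqF// expr0n/= mul0r.
have [i ti] := rV_neq0_exists t t0.
(* The parameter at which the nonzero coordinate [i] alone reaches modulus 1. *)
pose m := (`|t 0 i|^-1) `^ (beta i)^-1.
have ti0 : 0 < `|t 0 i|^-1 by rewrite invr_gt0 normr_gt0.
have m0 : 0 < m by rewrite powR_gt0.
have fm : 1 <= f m.
  rewrite /f /m (bigD1 i)//= -powRrM mulVf ?gt_eqF// powRr1 ?(ltW ti0)//.
  rewrite exprVn real_normK ?num_real// mulVf ?sqrf_eq0// lerDl sumr_ge0// => j _.
  by rewrite mulr_ge0// sqr_ge0.
(* The endpoint 0 is separate: powers are continuous at positive points by differentiability, while
   at 0 only the limit from the right is used, with positivity of the exponents. *)
have cf : {within `[0, m], continuous f}.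
  apply/continuous_within_itvP => //; split.
  - move=> x; rewrite in_itv/= => /andP[x0 _].
    apply: (cvg_sumr (fun j r => r `^ beta j ^+ 2 * t 0 j ^+ 2)) => j.
      apply: cvgM; last exact: cvg_cst.
    by rewrite expr2; under eq_fun do rewrite expr2; apply: cvgM; exact: continuous_powR.
  - rewrite f0; rewrite [X in _ --> X](_ : _ = \sum_(i < d) 0 ^+ 2 * (t 0 i) ^+ 2); last first.
      by rewrite big1// => j _; rewrite expr0n mul0r.
    apply: (cvg_sumr (fun j r => r `^ beta j ^+ 2 * t 0 j ^+ 2)
      (fun j => 0 ^+ 2 * t 0 j ^+ 2)) => j.
      apply: cvgM; last exact: cvg_cst.
    by rewrite expr2; under eq_fun do rewrite expr2; apply: cvgM; exact: powR_cvg0.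
  - apply: cvg_at_left_filter.
    apply: (cvg_sumr (fun j r => r `^ beta j ^+ 2 * t 0 j ^+ 2)) => j.
      apply: cvgM; last exact: cvg_cst.
    by rewrite expr2; under eq_fun do rewrite expr2; apply: cvgM; exact: continuous_powR.
have [|r rm fr] := IVT (ltW m0) cf (v := 1).
  by rewrite f0 ge_min ler01/= le_max fm orbT.
exists r; last by rewrite fE fr sqrtr1.
move: rm; rewrite in_itv/= => /andP[r0 _].
rewrite lt_neqAle r0 andbT; apply/eqP => e.
by move: fr; rewrite -e f0 => /eqP; rewrite eq_sym oner_eq0.
Qed.

Lemma rho_spec t : t != 0 -> 0 < rho beta t /\ enorm (dil beta (rho beta t)^-1 t) = 1.
Proof.
move=> t0; rewrite /rho (negbTE t0).
have [r r0 er] := dil_enorm1_exists t t0.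
apply: (@xgetPex _ 0 [set r | 0 < r /\ enorm (dil beta r^-1 t) = 1]).
by exists r^-1; split; [rewrite invr_gt0|rewrite invrK].
Qed.

Lemma rho_unique t r : t != 0 -> 0 < r -> enorm (dil beta r^-1 t) = 1 -> rho beta t = r.
Proof.
move=> t0 r0 er; have [p0 ep] := rho_spec t t0.
by apply: invr_inj; apply: (enorm_dil_inj t) => //; rewrite ?invr_gt0// ep er.
Qed.

Lemma rho0 : rho beta 0 = 0.
Proof. by rewrite /rho eqxx. Qed.

Lemma rho_ge0 t : 0 <= rho beta t.
Proof. by have [->|/rho_spec[/ltW]//] := eqVneq t 0; rewrite rho0. Qed.

Lemma rho_dil u t : 0 < u -> rho beta (dil beta u t) = u * rho beta t.
Proof.
move=> u0; have [->|t0] := eqVneq t 0.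
  have -> : dil beta u 0 = 0 by apply/eqP; rewrite dil_eq0.
  by rewrite rho0 mulr0.
have [p0 ep] := rho_spec t t0.
apply: rho_unique; rewrite ?dil_eq0 ?mulr_gt0//.
by rewrite invfM mulrC dilM ?invr_gt0// dilVK.
Qed.

(** Dilating by 1/rho(t) lands on the Euclidean unit sphere, where each coordinate has modulus at
    most 1; undoing the dilation multiplies coordinate i by rho(t)^(beta_i). *)
Lemma normr_coord_le_rho (t : 'rV[R]_d) i : `|t 0 i| `^ (beta i)^-1 <= rho beta t.
Proof.
have [->|t0] := eqVneq t 0.
  by rewrite mxE normr0 powR0 ?rho0// invr_eq0 gt_eqF.
have [p0 ep] := rho_spec t t0.
have h : `|t 0 i| <= rho beta t `^ beta i.
  have : `|dil beta (rho beta t)^-1 t 0 i| <= 1.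
    rewrite -ep /enorm -sqrtr_sqr ler_wsqrtr//.
    by rewrite (bigD1 i)//= lerDl sumr_ge0// => j _; rewrite sqr_ge0.
  rewrite dilE normrM ger0_norm ?powR_ge0//.
  rewrite -(@ler_pM2l _ (rho beta t `^ beta i)) ?powR_gt0// mulrA -powRM ?invr_ge0 ?(ltW p0)//.
  by rewrite divff ?gt_eqF// powR1 mul1r mulr1.
apply: (@le_trans _ _ ((rho beta t `^ beta i) `^ (beta i)^-1)).
  by apply: ge0_ler_powR; rewrite ?nnegrE ?powR_ge0// invr_ge0 ltW.
by rewrite -powRrM divff ?gt_eqF// powRr1// ltW.
Qed.

(* Comparing with the mean of the [|t_i|^(1/beta_i)] replaces [rho] by a
   function whose exponential is a product of functions of one variable. *)
Lemma expR_rho_le k (t : 'rV[R]_d) : (0 < d)%N -> 0 <= k ->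
  expR (- k * rho beta t) <=
  \prod_i expR (- (k / d%:R) * `|t 0 i| `^ (beta i)^-1).
Proof.
move=> d0 k0; have dR : 0 < d%:R :> R by rewrite ltr0n.
rewrite -expR_sum ler_expR -mulr_sumr !mulNr lerN2 -mulrA ler_wpM2l//.
rewrite mulrC ler_pdivrMr//.
have -> : rho beta t * d%:R = \sum_(i < d) rho beta t by rewrite sumr_const card_ord mulr_natr.
by apply: ler_sum => i _; exact: normr_coord_le_rho.
Qed.

(** A nonzero [t] is the dilation by rho(t) of a point with [rho] equal to 1, and homogeneity brings
    the factor out. At t = 0 the bound is nonnegativity of [G]. *)
Lemma homogeneous_ge_rho (G : 'rV[R]_d -> R) (m : R) : 
  (forall t u, 0 < u -> G (dil beta u t) = u * G t) ->
  (forall t, rho beta t = 1 -> m <= G t) -> (forall t, 0 <= G t) ->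
  forall t, m * rho beta t <= G t.
Proof.
move=> Gh Gm G0 t; have [->|t0] := eqVneq t 0; first by rewrite rho0 mulr0.
have [p0 ep] := rho_spec t t0.
rewrite -[t in leRHS](dilKV (rho beta t) p0) Gh// mulrC ler_pM2l//.
by apply: Gm; rewrite rho_dil ?invr_gt0// mulVf// gt_eqF.
Qed.

End rho.

(** * Measurability *)

Section measurability.
Context {R : realType}.

(** Balls of row vectors are those of the sup norm, hence finite intersections of coordinate
    preimages. Nonpositive radii are separate because in dimension 0 the empty intersection is the
    whole space. *)
Lemma measurable_ball_rV {n} (x : 'rV[R]_n) (e : R) : measurable (ball x e : set 'rV[R]_n).
Proof.
have [e0|e0] := leP e 0.
  rewrite (_ : ball x e = set0)//; apply/seteqP; split=> // y [/=].
  by rewrite ltNge e0.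
rewrite (_ : ball x e = \bigcap_(i in [set: 'I_n])
    ((fun y : 'rV[R]_n => y 0 i) @^-1` (ball (x 0 i) e))).
  apply: fin_bigcap_measurable => // i _.
  rewrite -[X in measurable X]setTI; apply: measurable_coord_rV => //.
  exact: measurable_ball.
apply/seteqP; split=> [y [_ h] i _|y h]; first exact: h.
by split=> // i j; rewrite ord1; exact: h.
Qed.

(** An open set is the countable union of the balls with rational centre and radius 1/(m+1) that it
    contains. This reconciles the topology with the coordinate sigma-algebra. *)
Lemma measurable_open_rV {n} (O : set 'rV[R]_n) : open O -> measurable O.
Proof.
move=> oO.
pose r (m : nat) : R := m.+1%:R^-1.
pose q (u : 'rV[rat]_n) : 'rV[R]_n := map_mx ratr u.
have -> : O = \bigcup_(um in [set um : 'rV[rat]_n * nat | ball (q um.1) (r um.2) `<=` O])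
    ball (q um.1) (r um.2).
  apply/seteqP; split=> [x Ox|x [um /= h]]; last exact: h.
  have /nbhs_ballP[e /= e0 xe] := oO _ Ox.
  (* Two radii [r m] add up to less than [e], so a ball of radius [r m] that contains x stays inside
     the ball of radius [e] around x. *)
  pose m := Num.truncn (2 / e).
  have re : r m + r m < e.
    have : 2 / e < m.+1%:R by exact: truncnS_gt.
    rewrite ltr_pdivrMr// => h.
    by rewrite -mulr2n -mulr_natl /r/= ltr_pdivrMr ?ltr0n// mulrC.
  have r0 : 0 < r m by rewrite invr_gt0.
  have hq (i : 'I_n) : exists w : rat, `|x 0 i - ratr w| < r m.
    have /rat_in_itvoo[w] : x 0 i - r m < x 0 i + r m by lra.
    rewrite in_itv/= => /andP[h1 h2]; exists w.
    by rewrite ltr_distlC h1 h2.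
  pose u : 'rV[rat]_n := \row_i xget 0 [set w : rat | `|x 0 i - ratr w| < r m].
  have hu i : `|x 0 i - q u 0 i| < r m.
    rewrite !mxE; exact: (xgetPex 0 (hq i)).
  exists (u, m) => /=.
    move=> y [_ hy]; apply: xe; split=> // i j; rewrite ord1.
    rewrite /ball/= (le_lt_trans _ re)//.
    apply: (le_trans (ler_distD (q u 0 j) _ _)).
    by apply: lerD; [exact: ltW|have := hy 0 j; rewrite /ball/= => /ltW].
  by split=> // i j; rewrite ord1 /ball/= distrC.
rewrite bigcup_mkcond; apply: countable_bigcupT_measurable => [|um].
  exact: countableP.
by case: ifP => // _; exact: measurable_ball_rV.
Qed.

Lemma continuous_measurable_rV {n} (O : set 'rV[R]_n) (N : ptopologicalType)
    (g : 'rV[R]_n -> N) : open O -> (forall x, O x -> {for x, continuous g}) ->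
  measurable_fun O (g : 'rV[R]_n -> borel N).
Proof.
move=> oO cg; apply: (@measurability _ _ _ (borel N) O g (@open N)) => // _ [B oB <-].
apply: measurable_open_rV; rewrite openE => x [Ox Bgx].
apply: filterI; first exact: oO.
by apply: (cg _ Ox); apply: open_nbhs_nbhs.
Qed.

Lemma continuous_borel_measurable (N : ptopologicalType) (g : N -> R) :
  continuous g -> measurable_fun setT (g : borel N -> R).
Proof.
move=> cg; apply: (@measurability _ _ (borel N) (measurableTypeR R) setT g (@RGenOpens.G R)).
  exact: RGenOpens.measurableE.
move=> _ [_ [x [y ->]] <-]; rewrite setTI; apply: sub_sigma_algebra.
by apply: open_comp => // z _; exact: cg.
Qed.

Lemma continuous_enorm {n} : continuous (@enorm R n).
Proof.
move=> x; apply: (@continuous_comp _ _ _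
  (fun t : 'rV[R]_n => \sum_i t 0 i ^+ 2)); last exact: sqrt_continuous.
apply: (cvg_sumr (FF := nbhs_filter x) (fun i (t : 'rV[R]_n) => t 0 i ^+ 2)) => i.
apply: (@continuous_comp _ _ _ (fun t : 'rV[R]_n => t 0 i) (fun y => y ^+ 2)).
  exact: coord_continuous.
exact: exprn_continuous.
Qed.

Lemma open_eball {n} (r : R) : open (@eball R n r).
Proof.
rewrite (_ : eball r = @enorm R n @^-1` [set x | x < r])//.
by apply: open_comp; [move=> x _; exact: continuous_enorm|exact: open_lt].
Qed.

End measurability.

(** The C^1 condition is joint in (p, s) and read in charts. It is restricted to the slice through
    the slice coordinates [u] of [p], and the chart [c'] of the target is then undone by its
    parametrisation. *)
Lemma continuous_nmap {R : realType} {n : nat} {N : riemannian_manifold R n}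
    {l : nat} {Sigma : 'I_l.+1 -> set N} {D : normal_cell_data N l}
    {vol : {measure set (borel N) -> \bar R}}
    {svol : 'I_l.+1 -> {measure set (borel N) -> \bar R}} {M : set N}
    (k : piece D) (p : N) (s : 'rV[R]_(codim D k)) :
  (forall j : 'I_l.+1, embedded_submanifold j (Sigma j)) ->
  normal_cells D vol Sigma svol M -> base k p -> eball (Defs.radius D) s ->
  {for s, continuous (nmap D k p)}.
Proof.
move=> HS HD Pp Bs.
have Sp : Sigma (sdim k) p by exact: (base_stratum _ _ _ _ _ _ _ _ _ HD).
have [_ [ch [ach sch] chp]] := HS (sdim k) p Sp.
have [c' ac' c'x] := atlas_cover (nmap D k p s).
have [u _ ue] : range (@pad R n (sdim k)) (Defs.coord ch p).
  have : (Defs.coord ch @` (dom ch `&` Sigma (sdim k))) (Defs.coord ch p) by exists p.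
  by rewrite sch => -[].
have [_ _ chK _ _] := atlas_chart ach.
have [_ _ c'K _ pc'] := atlas_chart ac'.
have pu : param ch (pad n u) = p by rewrite ue chK.
have [oO [dO _]] := nmap_C1 _ _ _ _ _ _ _ _ _ HD k ch c' (conj ach sch) ac'.
set O := (X in open X) in oO dO.
have Ous : O (u, s).
  split => //=; rewrite ?pu//.
  - by rewrite ue; exists p.
  - exact: (base_bnbhd _ _ _ _ _ _ _ _ _ HD).
have := differentiable_continuous (dO _ Ous) => /= cPhi.
have cpair : {for s, continuous (fun s' : 'rV[R]_(codim D k) => (u, s'))}.
  move=> B [[B1 B2] [/= hB1 hB2] h]; apply: filterS hB2 => s1 hs1.
  by apply: h; split=> //=; exact: nbhs_singleton.
have cg : {for s, continuous (fun s' => Defs.coord c' (nmap D k p s'))}.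
  have := @continuous_comp _ _ _ _ _ s cpair cPhi.
  by rewrite /comp/= pu.
(* Openness of [O] keeps nearby values inside the chart, the only place where [param c'] inverts the
   coordinates. *)
have nearO : \forall s' \near s, dom c' (nmap D k p s').
  have : nbhs (u, s) O by apply: open_nbhs_nbhs.
  move=> /cpair hO; have {hO} : nbhs s [set s1 | O (u, s1)] by exact: hO.
  apply: filterS => s1 [_ _ _] /=.
  by rewrite pu.
have cF : (fun s1 => param c' (Defs.coord c' (nmap D k p s1))) @ s --> nmap D k p s.
  rewrite -[X in _ --> X](c'K _ c'x).
  apply: (@continuous_comp _ _ _ _ (param c') s cg); apply: pc'.
  by exists (nmap D k p s).
apply: cvg_trans cF; apply: near_eq_cvg; first exact: nbhs_filter.
by move: nearO; apply: filterS => s1 /c'K.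
Qed.

(** * Laplace integrals over a dilated set *)

Section laplace.
Context {R : realType} {d : nat} (beta : 'I_d -> R).
Hypothesis beta0 : forall i, 0 < beta i.

Local Notation mu := (lebesgue_rV R d).
Local Notation Q := (\sum_i beta i).

Lemma measurable_dil u : measurable_fun setT (dil beta u).
Proof. exact: (measurable_row_scale (fun i => u `^ beta i)). Qed.

Lemma prod_powR (u : R) : 0 < u -> \prod_i u `^ beta i = u `^ Q.
Proof.
move=> u0; elim/big_rec2: _ => [|i x y _ ->]; first by rewrite powRr0.
by rewrite powRD// (gt_eqF u0) implybT.
Qed.

Lemma ge0_integral_dil (u : R) (h : 'rV[R]_d -> \bar R) : 0 < u ->
  measurable_fun setT h -> (forall t, (0 <= h t)%E) ->
  (\int[mu]_t h (dil beta u^-1 t) = (u `^ Q)%:E * \int[mu]_t h t)%E.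
Proof.
move=> u0 mh h0.
rewrite -(ge0_integral_row_scale (fun i => u^-1 `^ beta i) h)//; last first.
  by move=> i; rewrite powR_gt0 ?invr_gt0.
rewrite muleA -EFinM prod_powR ?invr_gt0// -powRM ?invr_ge0 ?(ltW u0)//.
by rewrite mulfV ?gt_eqF// powR1 mul1e.
Qed.

(** Stated in this direction because the majorant is available after the dilation. An infinite
    integral would stay infinite when multiplied by u^Q > 0. *)
Lemma integrable_dil (u : R) (h : 'rV[R]_d -> R) : 0 < u ->
  measurable_fun setT h ->
  mu.-integrable setT (EFin \o (h \o dil beta u^-1)) ->
  mu.-integrable setT (EFin \o h).
Proof.
move=> u0 mh /integrableP[_ hoo]; apply/integrableP; split; first exact/measurable_EFinP.
move: hoo; have := @ge0_integral_dil u (fun t => `|(h t)%:E|%E) u0.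
move=> /= ->//; last first.
  by apply/measurable_EFinP; exact: measurableT_comp.
have uQ : 0 < u `^ Q by rewrite powR_gt0.
rewrite !ltey => /eqP H; apply/eqP => E; apply: H.
by rewrite E gt0_muley ?lte_fin.
Qed.

Lemma Rintegral_dil (u : R) (h : 'rV[R]_d -> R) : 0 < u ->
  measurable_fun setT h -> mu.-integrable setT (EFin \o h) ->
  \int[mu]_t h (dil beta u^-1 t) = u `^ Q * \int[mu]_t h t.
Proof.
move=> u0 mh ih; rewrite /Rintegral.
have -> : (\int[mu]_t (h (dil beta u^-1 t))%:E = (u `^ Q)%:E * \int[mu]_t (h t)%:E)%E.
  have mh' : measurable_fun setT (EFin \o h) by exact/measurable_EFinP.
  have E1 := integralE mu setT ((EFin \o h) \o dil beta u^-1).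
  rewrite funepos_comp funeneg_comp in E1.
  have A1 := ge0_integral_dil u ((EFin \o h)^\+%E) u0
    (measurable_funepos mh') (fun t => funepos_ge0 _ t).
  have A2 := ge0_integral_dil u ((EFin \o h)^\-%E) u0
    (measurable_funeneg mh') (fun t => funeneg_ge0 _ t).
  have E2 := integralE mu setT (EFin \o h).
  apply: (eq_trans E1).
  apply: (eq_trans (f_equal2 (fun x y => (x - y)%E) A1 A2)).
  apply: (eq_trans _ (esym (f_equal (fun x => ((u `^ Q)%:E * x)%E) E2))).
  apply: esym; apply: muleBr => //.
  by apply: fin_num_adde_defr; exact: integrable_pos_fin_num.
by rewrite fineM//; apply: integrable_fin_num.
Qed.

(** A mean value estimate: for y <= x, e^x - e^y = (1 - e^(y-x)) e^x, and 1 - e^(-v) <= v. *)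
Lemma expR_sub_le (x y m : R) : x <= m -> y <= m ->
  `|expR x - expR y| <= `|x - y| * expR m.
Proof.
wlog yx : x y / y <= x.
  move=> h xm ym; have [yx|/ltW xy] := leP y x; first exact: h.
  by rewrite distrC (distrC x); exact: h.
move=> xm ym; rewrite !ger0_norm ?subr_ge0 ?ler_expR//.
have -> : expR x - expR y = (1 - expR (y - x)) * expR x.
  by rewrite mulrBl mul1r -expRD subrK.
apply: ler_pM; rewrite ?expR_ge0 ?ler_expR//.
  by rewrite subr_ge0 -expR0 ler_expR subr_le0.
by have := expR_ge1Dx (y - x); lra.
Qed.

(** Both exponents are at most -th G and differ by G |rem|. The unbounded factor G is absorbed by
    half of the decay, since G e^(-th G/2) <= 2/th. *)
Lemma expR_perturb_le (G rem th : R) : 0 < th -> 0 <= G -> `|rem| <= 1 - th ->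
  `|expR (- (G * (1 + rem))) - expR (- G)| <=
  2 / th * `|rem| * expR (- (th / 2 * G)).
Proof.
move=> th0 G0 hrem.
have [r1 r2] : - (1 - th) <= rem /\ rem <= 1 - th.
  by move/ler_normlP : (hrem) => [h1 h2]; split; lra.
have th1 : th <= 1 by have := normr_ge0 rem; lra.
apply: (le_trans (expR_sub_le _ _ (- (th * G)) _ _)).
- by rewrite lerN2 mulrC ler_wpM2l//; lra.
- by rewrite lerN2 ler_piMl.
have -> : - (G * (1 + rem)) - - G = - (G * rem) by ring.
rewrite normrN normrM (ger0_norm G0).
have -> : expR (- (th * G)) = expR (- (th / 2 * G)) * expR (- (th / 2 * G)).
  by rewrite -expRD; congr expR; field.
rewrite mulrA ler_wpM2r ?expR_ge0//.
rewrite [leRHS]mulrC (_ : _ * _ * _ = `|rem| * (G * expR (- (th / 2 * G)))); last by ring.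
rewrite ler_wpM2l//.
rewrite expRN ler_pdivrMr ?expR_gt0//.
have h := expR_ge1Dx (th / 2 * G).
apply: (@le_trans _ _ (2 / th * (th / 2 * G))).
  by rewrite mulrA mulf_div (mulrC th) divff ?mul1r// mulf_neq0 ?gt_eqF.
by rewrite ler_wpM2l ?divr_ge0 ?(ltW th0)//; lra.
Qed.

End laplace.

(** * Quantitative error for a single real-valued Laplace integral *)

Section error.
Context {R : realType} {d : nat} (beta : 'I_d -> R).
Hypothesis d0 : (0 < d)%N.
Hypothesis beta0 : forall i, 0 < beta i.

Local Notation mu := (lebesgue_rV R d).
Local Notation Q := (\sum_i beta i).

Definition rho_weight (k : R) (t : 'rV[R]_d) : R :=
  \prod_i expR (- (k / d%:R) * `|t 0 i| `^ (beta i)^-1).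

Lemma rho_weight_ge0 k t : 0 <= rho_weight k t.
Proof. by apply: prodr_ge0 => i _; exact: expR_ge0. Qed.

Lemma measurable_rho_weight k : measurable_fun setT (rho_weight k).
Proof.
exact: (measurable_prod_rV (fun i x => expR (- (k / d%:R) * `|x| `^ (beta i)^-1))
  (fun i => measurable_expR_powR _ _)).
Qed.

Lemma integrable_rho_weight k : 0 < k -> mu.-integrable setT (EFin \o rho_weight k).
Proof.
move=> k0; apply/integrableP; split.
  by apply/measurable_EFinP; exact: measurable_rho_weight.
under eq_integral do rewrite gee0_abs ?lee_fin ?rho_weight_ge0//.
apply: (integral_prod_rV_lty (fun i x => expR (- (k / d%:R) * `|x| `^ (beta i)^-1))).
- by move=> i; exact: measurable_expR_powR.
- by move=> i x; exact: expR_ge0.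
- by move=> i; apply: integral_expR_powR_lty; rewrite ?divr_gt0 ?ltr0n ?invr_gt0.
Qed.

(** The situation at one fixed p: [B] is the truncated cell, [C] its limit, u = z c(p), [phi] is z
    (f(F(p, .)) - f0), and [b], [b0] are real or imaginary parts of the amplitudes. Both [rem] and
    [b - b0] are at most [eta] where rho(s) <= r. *)
Context (u r K eta th g b0 : R) (B C : set 'rV[R]_d) (G rem b phi : 'rV[R]_d -> R).
Hypotheses (u0 : 0 < u) (K0 : 0 <= K) (eta0 : 0 <= eta) (th0 : 0 < th) (g0 : 0 < g).
Hypotheses (mB : measurable B) (mC : measurable C) (mG : measurable_fun setT G)
  (mb : measurable_fun B b) (mphi : measurable_fun B phi).
Hypothesis G_hom : forall t v, 0 < v -> G (dil beta v t) = v * G t.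
Hypothesis G_ge : forall t, g * rho beta t <= G t.
Hypothesis rem_le : forall s, B s -> `|rem s| <= 1 - th.
Hypothesis phiE : forall s, B s -> phi s = u * G s * (1 + rem s).
Hypothesis b_le : forall s, B s -> `|b s| <= K.
Hypothesis b0_le : `|b0| <= K.
Hypothesis b_near : forall s, B s -> rho beta s <= r -> `|b s - b0| <= eta.
Hypothesis rem_near : forall s, B s -> rho beta s <= r -> `|rem s| <= eta.

Local Notation kappa := (th * g / 4).
Local Notation DB := (dil beta u @` B).

Lemma image_dilE : DB = dil beta u^-1 @^-1` B.
Proof.
apply/seteqP; split=> [_ [s Bs <-]|t Bt] /=; first by rewrite dilVK.
by exists (dil beta u^-1 t) => //; rewrite dilKV.
Qed.

Let G_ge0 t : 0 <= G t.
Proof. by apply: le_trans (G_ge t); rewrite mulr_ge0 ?rho_ge0// ltW. Qed.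

Let phi_dil t : B (dil beta u^-1 t) ->
  phi (dil beta u^-1 t) = G t * (1 + rem (dil beta u^-1 t)).
Proof. by move=> Bs; rewrite phiE// G_hom ?invr_gt0// mulVKf ?gt_eqF. Qed.

Let kappa0 : 0 < kappa.
Proof. by rewrite divr_gt0// mulr_gt0. Qed.

Let expR_G_le t : expR (- (th / 4 * G t)) <= rho_weight kappa t.
Proof.
apply: le_trans (expR_rho_le beta beta0 kappa t d0 (ltW kappa0)).
rewrite ler_expR mulNr lerN2 (_ : kappa * _ = th / 4 * (g * rho beta t)); last by field.
by rewrite ler_wpM2l// divr_ge0// ltW.
Qed.

Let th_le1 s : B s -> th <= 1.
Proof. by move=> /rem_le; have := normr_ge0 (rem s); lra. Qed.

(** Extension by zero turns both domains into indicators, so the two integrals can be compared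
    pointwise on the whole space. *)
Let f1 (s : 'rV[R]_d) : R := ((fun s => b s * expR (- phi s)) \_ B) s.
Let f2 (t : 'rV[R]_d) : R := ((fun t => b0 * expR (- G t)) \_ C) t.

Let mf1 : measurable_fun setT f1.
Proof.
apply/(measurable_restrictT _ mB); apply: measurable_funM => //.
by apply: measurableT_comp => //; exact: measurableT_comp.
Qed.

Let mf2 : measurable_fun setT f2.
Proof.
apply/(measurable_restrictT _ mC); apply: measurable_funM => //.
by apply: measurable_funTS; apply: measurableT_comp => //; exact: measurableT_comp.
Qed.

Let f1_le t : `|f1 (dil beta u^-1 t)| <= K * rho_weight kappa t.
Proof.
rewrite /f1 patchE; case: ifPn => [/set_mem Bs|_]; last first.
  by rewrite normr0 mulr_ge0 ?rho_weight_ge0.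
rewrite normrM (ger0_norm (expR_ge0 _)) ler_pM ?expR_ge0 ?b_le//.
apply: le_trans (expR_G_le t); rewrite ler_expR lerN2 phi_dil// mulrC ler_wpM2l//.
move/ler_normlP : (rem_le _ Bs) => [h1 h2]; have := th0; lra.
Qed.

Let f2_le t : th <= 1 -> `|f2 t| <= K * rho_weight kappa t.
Proof.
move=> th1; rewrite /f2 patchE; case: ifPn => _; last first.
  by rewrite normr0 mulr_ge0 ?rho_weight_ge0.
rewrite normrM (ger0_norm (expR_ge0 _)) ler_pM ?expR_ge0//.
apply: le_trans (expR_G_le t); rewrite ler_expR lerN2 ler_piMl//.
by lra.
Qed.

Let iw : mu.-integrable setT (EFin \o (fun t => K * rho_weight kappa t)).
Proof.
have -> : EFin \o (fun t => K * rho_weight kappa t) =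
    (fun t => K%:E * (EFin \o rho_weight kappa) t)%E.
  by apply/funext => t; rewrite /= EFinM.
by apply: integrableZl => //; exact: integrable_rho_weight.
Qed.

Let if1d : mu.-integrable setT (EFin \o (f1 \o dil beta u^-1)).
Proof.
apply: le_integrable iw => //.
- apply/measurable_EFinP; apply: measurableT_comp => //; exact: measurable_dil.
- move=> t _ /=; rewrite lee_fin (ger0_norm (mulr_ge0 K0 (rho_weight_ge0 _ _))).
  exact: f1_le.
Qed.

(** After dilation the integrand is dominated by K times the majorant; [integrable_dil] carries this
    back. *)
Lemma integrable_laplace : mu.-integrable B (EFin \o (fun s => b s * expR (- phi s))).
Proof.
apply/(integrable_mkcond _ mB); rewrite restrict_EFin.
by apply: (integrable_dil beta u f1).
Qed.

(* The first term comes from the region [rho t <= r u], the second one from its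
   complement, where half of the exponential decay is given up. *)
Let near_le t : B (dil beta u^-1 t) ->
  `|b (dil beta u^-1 t) * expR (- phi (dil beta u^-1 t)) - b0 * expR (- G t)| <=
  ((1 + 2 * K / th) * eta + (2 * K + 2 * K / th) * expR (- (kappa * r * u))) *
  rho_weight kappa t.
Proof.
set s := dil beta u^-1 t => Bs.
have c0 : 0 <= 2 * K / th by rewrite divr_ge0 ?mulr_ge0// ltW.
have th1 := th_le1 s Bs.
have e2 : 0 <= expR (- (th / 2 * G t)) by exact: expR_ge0.
have h1 : `|b s * expR (- phi s) - b0 * expR (- G t)| <=
    (`|b s - b0| + 2 * K / th * `|rem s|) * expR (- (th / 2 * G t)).
  rewrite phi_dil// -/s.
  (* The remainder is removed first, with amplitude [b0], and the amplitude is changed under the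
     perturbed exponential, whose decay is still at least th G. *)
  have -> : b s * expR (- (G t * (1 + rem s))) - b0 * expR (- G t) =
     b0 * (expR (- (G t * (1 + rem s))) - expR (- G t)) +
     (b s - b0) * expR (- (G t * (1 + rem s))) by ring.
  rewrite (le_trans (ler_normD _ _))// [leLHS]addrC [leRHS]mulrDl !normrM lerD//.
    rewrite ler_wpM2l// (ger0_norm (expR_ge0 _)) ler_expR lerN2 mulrC ler_wpM2l//.
    by move/ler_normlP : (rem_le _ Bs) => [? ?]; have := th0; lra.
  apply: (le_trans (ler_pM _ _ b0_le (expR_perturb_le _ _ th th0 (G_ge0 t) (rem_le _ Bs)))) => //.
  by rewrite le_eqVlt; apply/orP; left; apply/eqP; field; rewrite gt_eqF.
apply: (le_trans h1).
have e4 : expR (- (th / 2 * G t)) <= rho_weight kappa t.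
  apply: le_trans (expR_G_le t); rewrite ler_expR lerN2 ler_wpM2r//; have := th0; lra.
have p1 : 0 <= (1 + 2 * K / th) * eta by rewrite mulr_ge0// addr_ge0.
have p2 : 0 <= (2 * K + 2 * K / th) * expR (- (kappa * r * u)).
  by rewrite mulr_ge0 ?expR_ge0// addr_ge0// mulr_ge0.
have [sr|sr] := leP (rho beta s) r.
  apply: ler_pM => //; first by rewrite addr_ge0// mulr_ge0.
  rewrite (@le_trans _ _ ((1 + 2 * K / th) * eta)) ?lerDl//.
  rewrite [leRHS]mulrDl mul1r lerD ?b_near// ler_wpM2l// rem_near//.
rewrite (@le_trans _ _ ((2 * K + 2 * K / th) * expR (- (kappa * r * u)) *
  rho_weight kappa t))//; last first.
  by rewrite ler_wpM2r ?rho_weight_ge0// lerDr.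
rewrite -[leRHS]mulrA; apply: ler_pM => //; first by rewrite addr_ge0// mulr_ge0.
  apply: lerD.
    by rewrite (le_trans (ler_normB _ _))// mulr_natl mulr2n lerD// b_le.
  by rewrite ler_piMr//; have := th0; have := rem_le _ Bs; lra.
apply: (@le_trans _ _ (expR (- (kappa * r * u)) * expR (- (th / 4 * G t)))); last first.
  by rewrite ler_wpM2l ?expR_ge0.
rewrite -expRD ler_expR -opprD lerN2.
have : g * (u * r) <= G t.
  apply: le_trans (G_ge t); rewrite ler_wpM2l ?(ltW g0)//.
  have -> : rho beta t = u * rho beta s by rewrite rho_dil ?invr_gt0// mulVKf ?gt_eqF.
  by rewrite ler_wpM2l ?ltW.
move=> h; have -> : kappa * r * u = th / 4 * (g * (u * r)) by field.
rewrite -mulrDr (_ : th / 2 * G t = th / 4 * (G t + G t)); last by field.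
by rewrite ler_wpM2l ?divr_ge0 ?(ltW th0)// lerD2r.
Qed.

(** On the dilated cell the difference of the integrands is the term of [near_le] plus [b0] times a
    difference of indicators; off it only the latter remains. The rate 1 - 1/2 is the cell
    hypothesis at delta = 1/2, whose weight dominates e^(-G). *)
Lemma laplace_error : th <= 1 ->
  (`|u `^ Q * (\int[mu]_(s in B) (b s * expR (- phi s))) -
     b0 * (\int[mu]_(t in C) expR (- G t))|%:E <=
  ((1 + 2 * K / th) * eta + (2 * K + 2 * K / th) * expR (- (kappa * r * u)))%:E *
    (\int[mu]_t (rho_weight kappa t)%:E) +
  K%:E * (\int[mu]_t (`|\1_DB t - \1_C t| * expR (- (1 - 2^-1) * G t))%:E))%E.
Proof.
move=> th1.
have if2 : mu.-integrable setT (EFin \o f2).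
  apply: le_integrable iw => //; first exact/measurable_EFinP.
  move=> t _ /=; rewrite lee_fin (ger0_norm (mulr_ge0 K0 (rho_weight_ge0 _ _))).
  exact: f2_le.
have ieG : mu.-integrable C (EFin \o (fun t => expR (- G t))).
  apply: (@integrableS _ _ _ mu setT) => //.
  apply: le_integrable (integrable_rho_weight kappa kappa0) => //.
    by apply/measurable_EFinP; apply: measurableT_comp => //; exact: measurableT_comp.
  move=> t _ /=; rewrite lee_fin !ger0_norm ?expR_ge0 ?rho_weight_ge0//.
  apply: le_trans (expR_G_le t); rewrite ler_expR lerN2 ler_piMl//; have := th0; lra.
have mDB : measurable DB.
  by rewrite image_dilE -[X in measurable X]setTI; apply: measurable_dil.
rewrite (Rintegral_mkcond _ B) -/f1 -(Rintegral_dil beta u f1)//; last first.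
  exact: (integrable_dil beta u f1).
rewrite -RintegralZl// (Rintegral_mkcond _ C) -/f2.
rewrite -RintegralB//.
rewrite EFin_normr_Rintegral//; last first.
  by have := integrableB measurableT if1d if2; apply: eq_integrable.
set c := (_ + _ * expR (- (kappa * r * u))).
have c0 : 0 <= c.
  have c1 : 0 <= 2 * K / th by rewrite divr_ge0 ?mulr_ge0// ltW.
  by rewrite addr_ge0// mulr_ge0 ?expR_ge0// addr_ge0// mulr_ge0.
pose h (t : 'rV[R]_d) : R := `|\1_DB t - \1_C t| * expR (- (1 - 2^-1) * G t).
have h0 t : 0 <= h t by rewrite mulr_ge0 ?expR_ge0.
have mh : measurable_fun setT h.
  apply: measurable_funM.
    by apply: measurableT_comp => //; apply: measurable_funB; exact: measurable_indic.
  by apply: measurableT_comp => //; exact: measurable_funM.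
have mw := measurable_rho_weight kappa.
have md : measurable_fun setT (fun t => f1 (dil beta u^-1 t) - f2 t).
  by apply: measurable_funB => //; apply: measurableT_comp => //; exact: measurable_dil.
apply: (le_trans (le_abse_integral _ _ _)) => //; first exact/measurable_EFinP.
rewrite -ge0_integralZl//; last 2 first.
- exact/measurable_EFinP.
- by move=> t _; rewrite lee_fin rho_weight_ge0.
have -> : (K%:E * \int[mu]_t (h t)%:E = \int[mu]_t (K%:E * (h t)%:E))%E.
  by rewrite ge0_integralZl//; [exact/measurable_EFinP|move=> t _; rewrite lee_fin].
rewrite -ge0_integralD//; last 4 first.
- by move=> t _; rewrite -EFinM lee_fin mulr_ge0 ?rho_weight_ge0.
- by apply: emeasurable_funM => //; exact/measurable_EFinP.
- by move=> t _; rewrite -EFinM lee_fin mulr_ge0.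
- by apply: emeasurable_funM => //; exact/measurable_EFinP.
apply: ge0_le_integral => //.
- by apply: measurableT_comp => //; exact/measurable_EFinP.
- apply: emeasurable_funD; apply: emeasurable_funM => //; exact/measurable_EFinP.
move=> t _; rewrite -!EFinM -EFinD lee_fin.
have e2 : expR (- G t) <= expR (- (1 - 2^-1) * G t).
  by rewrite ler_expR mulNr lerN2 ler_piMl//; lra.
have cw : 0 <= c * rho_weight kappa t by rewrite mulr_ge0 ?rho_weight_ge0.
have [DBt|DBt] := pselect (DB t).
  have Bs : B (dil beta u^-1 t) by move: DBt; rewrite image_dilE.
  have -> : f1 (dil beta u^-1 t) - f2 t =
    (b (dil beta u^-1 t) * expR (- phi (dil beta u^-1 t)) - b0 * expR (- G t)) +
    b0 * ((\1_DB t - \1_C t) * expR (- G t)).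
    (* A restricted function takes the default value [point] outside its domain, which for reals is
       0. *)
    rewrite /f1 /f2 !patchE !indicE (mem_set Bs) (mem_set DBt).
    by case: (t \in C) => /=; rewrite -?[point]/(0 : R); ring.
  apply: (le_trans (ler_normD _ _)); apply: lerD; first exact: near_le.
  by rewrite !normrM (ger0_norm (expR_ge0 _)) /h ler_pM ?mulr_ge0 ?expR_ge0// ler_wpM2l.
have Bs : ~ B (dil beta u^-1 t) by move: DBt; rewrite image_dilE.
have -> : f1 (dil beta u^-1 t) - f2 t = b0 * ((\1_DB t - \1_C t) * expR (- G t)).
  rewrite /f1 /f2 !patchE !indicE (memNset Bs) (memNset DBt).
  by case: (t \in C) => /=; rewrite -?[point]/(0 : R); ring.
rewrite (@le_trans _ _ (K * h t)) ?lerDr//.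
by rewrite !normrM (ger0_norm (expR_ge0 _)) /h ler_pM ?mulr_ge0 ?expR_ge0// ler_wpM2l.
Qed.

End error.

(** * Uniform asymptotics *)

Section supr0.
Context {R : realType}.
Local Open Scope ereal_scope.

Lemma supr0_ge0 {T : Type} (S : set T) (h : T -> \bar R) : 0 <= supr0 S h.
Proof. by apply: ereal_sup_ubound; left. Qed.

Lemma supr0_ub {T : Type} (S : set T) (h : T -> \bar R) x : S x -> h x <= supr0 S h.
Proof. by move=> Sx; apply: ereal_sup_ubound; right; exists x. Qed.

Lemma supr0_le {T : Type} (S : set T) (h : T -> \bar R) c :
  0 <= c -> (forall x, S x -> h x <= c) -> supr0 S h <= c.
Proof.
by move=> c0 hc; apply: ge_ereal_sup => _ [->//|[x Sx <-]]; exact: hc.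
Qed.

Lemma cvge0_near {T : Type} {F : set_system T} (h : T -> \bar R) (e : R) :
  h @ F --> 0 -> (0 < e)%R -> \forall x \near F, h x < e%:E.
Proof.
move=> hF e0; apply: (hF [set y | y < e%:E]); apply: open_nbhs_nbhs; split.
  exact: open_ereal_lt_ereal.
by rewrite /= lte_fin.
Qed.

Lemma near_cvge0 {T : Type} {F : set_system T} {FF : Filter F} (h : T -> \bar R) :
  (forall x, 0 <= h x) ->
  (forall e : R, (0 < e)%R -> \forall x \near F, h x <= e%:E) -> h @ F --> 0.
Proof.
move=> h0 he A hA0; have /nbhs_ballP[e /= e0 hA] : nbhs (0 : R)%R [set r | A r%:E] by [].
have e2 : (0 < e / 2)%R by rewrite divr_gt0.
apply: filterS (he _ e2) => x hx.
have hfin : h x \is a fin_num by rewrite ge0_fin_numE// (le_lt_trans hx)// ltry.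
suff : A (h x) by []; move: (h0 x) hx hfin; case: (h x) => //= r.
rewrite !lee_fin => r0 rx _; apply: (hA r).
by rewrite /ball/= sub0r normrN ger0_norm//; lra.
Qed.

End supr0.

(** Three errors of size e/3 from [laplace_error]: closeness [eta] near the origin, the exponential
    tail, and the cell defect. Uniformity holds because c(p) >= cmin makes the threshold on [z]
    independent of [p]. *)
Lemma uniform_laplace {R : realType} {d : nat} (beta : 'I_d -> R)
    {T : Type} (P : set T) (B C : T -> set 'rV[R]_d) (c b0 : T -> R)
    (G rem b phi : T -> 'rV[R]_d -> R) (cmin K th g : R) :
  (0 < d)%N -> (forall i, 0 < beta i) ->
  0 < cmin -> 0 <= K -> 0 < th <= 1 -> 0 < g ->
  (forall p, P p -> cmin <= c p) ->
  (forall p, P p -> measurable (B p)) ->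
  (forall p, P p -> measurable (C p)) ->
  (forall p, P p -> measurable_fun setT (G p)) ->
  (forall p, P p -> measurable_fun (B p) (b p)) ->
  (forall p, P p -> measurable_fun (B p) (phi p)) ->
  (forall p t v, P p -> 0 < v -> G p (dil beta v t) = v * G p t) ->
  (forall p t, P p -> g * rho beta t <= G p t) ->
  (forall p s, P p -> B p s -> `|rem p s| <= 1 - th) ->
  (forall p s, P p -> B p s -> phi p s = c p * G p s * (1 + rem p s)) ->
  (forall p s, P p -> B p s -> `|b p s| <= K) ->
  (forall p, P p -> `|b0 p| <= K) ->
  (forall eta, 0 < eta -> exists2 r, 0 < r & forall p s, P p -> B p s ->
     rho beta s <= r -> `|rem p s| <= eta /\ `|b p s - b0 p| <= eta) ->
  (forall eta, 0 < eta -> \forall z \near +oo, forall p, P p ->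
     (\int[lebesgue_rV R d]_t (`|\1_(dil beta (z * c p) @` B p) t - \1_(C p) t|
         * expR (- (1 - 2^-1) * G p t))%:E <= eta%:E)%E) ->
  forall e, 0 < e -> \forall z \near +oo, forall p, P p ->
    `|(z * c p) `^ (\sum_i beta i) *
        (\int[lebesgue_rV R d]_(s in B p) (b p s * expR (- (z * phi p s)))) -
      b0 p * (\int[lebesgue_rV R d]_(t in C p) expR (- G p t))| <= e.
Proof.
move=> d0 beta0 cmin0 K0 /andP[th0 th1] g0 cP mB mC mG mb mphi G_hom G_ge
  rem_le phiE b_le b0_le near0 nearC e e0.
pose kappa := th * g / 4.
have kappa0 : 0 < kappa by rewrite divr_gt0// mulr_gt0.
have [_ Woo] := integrableP _ _ _ (integrable_rho_weight beta d0 beta0 kappa kappa0).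
have [W WE] : exists W, (\int[lebesgue_rV R d]_t (rho_weight beta kappa t)%:E = W%:E)%E.
  exists (fine (\int[lebesgue_rV R d]_t (rho_weight beta kappa t)%:E)).
  rewrite fineK// ge0_fin_numE ?integral_ge0//; last first.
    by move=> t _; rewrite lee_fin rho_weight_ge0.
  by move: Woo; under eq_integral do rewrite /= ger0_norm ?rho_weight_ge0//.
have W0 : 0 <= W.
  by rewrite -lee_fin -WE integral_ge0// => t _; rewrite lee_fin rho_weight_ge0.
have k0 : 0 <= 2 * K / th by rewrite divr_ge0 ?mulr_ge0// ltW.
pose C1 := 1 + 2 * K / th; pose C2 := 2 * K + 2 * K / th.
have C10 : 0 <= C1 by rewrite addr_ge0.
have C20 : 0 <= C2 by rewrite addr_ge0// mulr_ge0.
(* Makes C1 eta W <= e/3; the added 1 avoids a vanishing denominator, here and in the factor K + 1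
   below. *)
pose eta := e / (3 * (C1 * W + 1)).
have CW : 0 < C1 * W + 1 by rewrite ltr_wpDl ?mulr_ge0.
have eta0 : 0 < eta by rewrite divr_gt0// mulr_gt0.
have etaE : C1 * eta * W <= e / 3.
  have -> : C1 * eta * W = (e / 3) * (C1 * W / (C1 * W + 1)) by rewrite /eta; field; lra.
  by rewrite ler_piMr ?divr_ge0 ?(ltW e0)// ler_pdivrMr// mul1r lerDl.
have [r r0 hr] := near0 eta eta0.
have eK : 0 < e / (3 * (K + 1)) by rewrite divr_gt0// mulr_gt0// ltr_wpDl.
have x0 : 0 < kappa * r * cmin by rewrite !mulr_gt0.
have near1 := nearC _ eK.
near=> z => p Pp.
have z0 : 0 < z by near: z; exact: nbhs_pinfty_gt.
(* With x = kappa r cmin z this says 3 C2 W / e < x, and e^x >= 1 + x then gives C2 W e^(-x) <=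
   e/3. *)
have zZ : 3 * (C2 * W) / e / (kappa * r * cmin) < z.
  by near: z; apply: nbhs_pinfty_gt; rewrite num_real.
have hC : (\int[lebesgue_rV R d]_t (`|\1_(dil beta (z * c p) @` B p) t - \1_(C p) t|
         * expR (- (1 - 2^-1) * G p t))%:E <= (e / (3 * (K + 1)))%:E)%E.
  by move: p Pp; near: z; exact: near1.
have cp0 : 0 < c p by apply: lt_le_trans (cP _ Pp).
have u0 : 0 < z * c p by rewrite mulr_gt0.
have mzphi : measurable_fun (B p) (fun s => z * phi p s).
  by apply: measurable_funM => //; exact: mphi.
have hB s : B p s -> rho beta s <= r -> `|rem p s| <= eta /\ `|b p s - b0 p| <= eta.
  exact: hr.
have := @laplace_error R d beta d0 beta0 (z * c p) r K eta th g (b0 p) (B p) (C p)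
  (G p) (rem p) (b p) (fun s => z * phi p s) u0 K0 (ltW eta0) th0 g0 (mB _ Pp)
  (mC _ Pp) (mG _ Pp) (mb _ Pp) mzphi (fun t v => G_hom p t v Pp)
  (fun t => G_ge p t Pp) (fun s => rem_le p s Pp) _ (fun s => b_le p s Pp) (b0_le _ Pp)
  (fun s Bs sr => (hB s Bs sr).2) (fun s Bs sr => (hB s Bs sr).1) th1.
have phiE' s : B p s -> z * phi p s = z * c p * G p s * (1 + rem p s).
  by move=> Bs; rewrite phiE// !mulrA.
move=> /(_ phiE'); rewrite WE -/kappa -/C1 -/C2 => h.
rewrite -lee_fin; apply: (le_trans h).
have hexp : C2 * expR (- (kappa * r * (z * c p))) * W <= e / 3.
  have y0 : 0 < kappa * r * cmin * z by rewrite mulr_gt0.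
  have : 3 * (C2 * W) / e <= kappa * r * cmin * z by rewrite -ler_pdivrMl// mulrC ltW.
  rewrite ler_pdivrMr// => h1.
  apply: (@le_trans _ _ (C2 * W * expR (- (kappa * r * cmin * z)))).
    rewrite mulrAC ler_wpM2l ?mulr_ge0// ler_expR lerN2.
    rewrite (_ : kappa * r * cmin * z = kappa * r * (z * cmin)); last by ring.
    apply: ler_wpM2l; first by rewrite mulr_ge0 ?(ltW kappa0) ?(ltW r0).
    by apply: ler_wpM2l; [exact: ltW|exact: cP].
  rewrite expRN ler_pdivrMr ?expR_gt0//.
  have h2 := expR_ge1Dx (kappa * r * cmin * z).
  apply: (@le_trans _ _ (e / 3 * (kappa * r * cmin * z))); first by lra.
  by rewrite ler_wpM2l ?divr_ge0 ?(ltW e0)//; lra.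
have hK : K * (e / (3 * (K + 1))) <= e / 3.
  have K1 : 0 < K + 1 by rewrite ltr_wpDl.
  have -> : K * (e / (3 * (K + 1))) = (e / 3) * (K / (K + 1)) by field; lra.
  by rewrite ler_piMr ?divr_ge0 ?(ltW e0)// ler_pdivrMr// mul1r lerDl.
apply: (@le_trans _ _ ((C1 * eta + C2 * expR (- (kappa * r * (z * c p))))%:E * W%:E +
   K%:E * (e / (3 * (K + 1)))%:E)%E).
  by apply: leeD => //; apply: lee_wpmul2l => //; rewrite lee_fin.
rewrite -!EFinM -EFinD lee_fin mulrDl; lra.
Unshelve. all: by end_near.
Qed.

(** * Normal cells *)

Section normc.
Context {R : realType}.
Implicit Type x : R[i].

Lemma normc_le_ReD x : normc x <= `|complex.Re x| + `|complex.Im x|.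
Proof.
case: x => a b /=; rewrite -[leRHS]ger0_norm ?addr_ge0// -sqrtr_sqr ler_wsqrtr//.
by rewrite sqrrD !real_normK ?num_real// lerD2r lerDl mulrn_wge0// mulr_ge0.
Qed.

Lemma normr_Re_le x : `|complex.Re x| <= normc x.
Proof. by case: x => a b /=; rewrite -sqrtr_sqr ler_wsqrtr// lerDl sqr_ge0. Qed.

Lemma normr_Im_le x : `|complex.Im x| <= normc x.
Proof. by case: x => a b /=; rewrite -sqrtr_sqr ler_wsqrtr// lerDr sqr_ge0. Qed.

Lemma Re_mulC x (r : R) : complex.Re (x * r%:C%C) = complex.Re x * r.
Proof. by case: x => a b /=; rewrite mulr0 subr0. Qed.

Lemma Im_mulC x (r : R) : complex.Im (x * r%:C%C) = complex.Im x * r.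
Proof. by case: x => a b /=; rewrite mulr0 add0r. Qed.

Lemma ReB x y : complex.Re (x - y) = complex.Re x - complex.Re y.
Proof. by case: x y => [a b] [c d]. Qed.

Lemma ImB x y : complex.Im (x - y) = complex.Im x - complex.Im y.
Proof. by case: x y => [a b] [c d]. Qed.

End normc.

(** * Measurability over a fixed base point *)

Section normal_cell_measurability.
Context {R : realType} {n : nat} {N : riemannian_manifold R n} {l : nat}.
Context {D : normal_cell_data N l} {vol : {measure set (borel N) -> \bar R}}.
Context {Sigma : 'I_l.+1 -> set N}.
Context {svol : 'I_l.+1 -> {measure set (borel N) -> \bar R}} {M : set N}.
Hypothesis HD : normal_cells D vol Sigma svol M.

Lemma measurable_tgraph (k : piece D) : measurable (tgraph D k).
Proof.
have -> : tgraph D k = [set q | base k q.1 /\ cell D k q.1 q.2] `&`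
    (setT `*` eball (Defs.radius D)).
  by apply/seteqP; split=> q /= [] => [? [? ?]|[? ?] [_ ?]].
apply: measurableI; first exact: (cell_measurable _ _ _ _ _ _ _ _ _ HD).
by apply: measurableX => //; apply: measurable_open_rV; exact: open_eball.
Qed.

Lemma measurable_tcell (k : piece D) (p : N) : base k p -> measurable (tcell D k p).
Proof.
move=> Pp; have := measurable_xsection (p : borel N) (measurable_tgraph k).
by congr measurable; apply/seteqP; split=> s; rewrite /xsection/= inE; [case|split].
Qed.

Lemma measurable_jac (k : piece D) (p : N) : base k p ->
  measurable_fun (tcell D k p) (jac D k p).
Proof.
move=> Pp.
have mp : measurable_fun (tcell D k p) (fun s => (p : borel N, s)).
  by apply: measurable_funTS; exact: pair1_measurable.
apply: (measurable_comp (measurable_tgraph k) _ (jac_measurable _ _ _ _ _ _ _ _ _ HD k) mp).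
by move=> _ [s Bs <-].
Qed.

Lemma measurable_nmap (k : piece D) (p : N) :
  (forall j : 'I_l.+1, embedded_submanifold j (Sigma j)) -> base k p ->
  measurable_fun (tcell D k p) (nmap D k p : _ -> borel N).
Proof.
move=> HS Pp; apply: (measurable_funS (E := eball (Defs.radius D))).
- by apply: measurable_open_rV; exact: open_eball.
- by move=> s [].
apply: continuous_measurable_rV; first exact: open_eball.
by move=> s Bs; exact: (continuous_nmap k p s HS HD Pp Bs).
Qed.

End normal_cell_measurability.

Lemma half_itv (R : realType) : 0 < (2^-1 : R) < 1.
Proof. by apply/andP; split; lra. Qed.

Theorem corollary3p14
  (R : realType) (n : nat) (N : riemannian_manifold R n)
  (vol : {measure set (borel N) -> \bar R})
  (Hvol : riemannian_volume n setT vol)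
  (f : N -> R) (Hf : continuous f) (Hf_lb : has_lbound (range f))
  (a : N -> R[i]) (Ha : cmeasurable_fun (setT : set (borel N)) a)
  (f0 := inf (range f)) (M := [set x : N | f x = f0])
  (HM0 : M !=set0) (HMc : compact M)
  (* strata *)
  (l : nat) (Sigma : 'I_l.+1 -> set N)
  (HSigma : forall j : 'I_l.+1, embedded_submanifold j (Sigma j))
  (HSigma_disj : trivIset setT Sigma)
  (HSigma_cover : \bigcup_(j in [set: 'I_l.+1]) Sigma j = M)
  (svol : 'I_l.+1 -> {measure set (borel N) -> \bar R})
  (Hsvol : forall j : 'I_l.+1, riemannian_volume j (Sigma j) (svol j))
  (* normal-cell decomposition, and the fixed piece *)
  (D : normal_cell_data N l) (HD : normal_cells D vol Sigma svol M)
  (k : piece D) (d := codim D k) (Hd : (1 <= d)%N)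
  (P : set (borel N) := base k)
  (F : N -> 'rV[R]_d -> N := nmap D k)
  (A : N -> set 'rV[R]_d := cell D k)
  (AB : N -> set 'rV[R]_d := tcell D k)
  (b : N -> 'rV[R]_d -> R[i] := fun p s => a (F p s) * (jac D k p s)%:C%C)
  (* scaling data *)
  (beta : 'I_d -> R) (Hbeta : forall i, 0 < beta i)
  (Q := \sum_i beta i)
  (c : N -> R) (Hc_meas : measurable_fun P (c : borel N -> R))
  (cmin cmax : R) (Hcmin : 0 < cmin)
  (Hc : forall p, P p -> cmin <= c p <= cmax)
  (G : N -> 'rV[R]_d -> R)
  (HG_meas : measurable_fun (P `*` setT)
    (fun q : borel N * 'rV[R]_d => G q.1 q.2))
  (HG_ge0 : forall p t, P p -> 0 <= G p t)
  (HG_hom : forall p t u, P p -> 0 < u -> G p (dil beta u t) = u * G p t)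
  (gmin gmax : R) (Hgmin : 0 < gmin)
  (HG : forall p t, P p -> rho beta t = 1 -> gmin <= G p t <= gmax)
  (Rem : N -> 'rV[R]_d -> R)
  (HRem_meas : measurable_fun (tgraph D k)
    (fun q : borel N * 'rV[R]_d => Rem q.1 q.2))
  (Hexp : forall p s, P p -> AB p s ->
    f (F p s) - f0 = c p * G p s * (1 + Rem p s))
  (HRem0 : forall p, P p -> Rem p 0 = 0)
  (HRem_lim :
    supr0 P (fun p => supr0 [set s | A p s /\ rho beta s <= r]
      (fun s => `|Rem p s|%:E)) @[r --> 0^'+] --> 0%E)
  (Ainf : N -> set 'rV[R]_d)
  (HAinf_meas : measurable
    ([set q | P q.1 /\ Ainf q.1 q.2] : set (borel N * 'rV[R]_d)))
  (HAinf : forall delta : R, 0 < delta < 1 ->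
    supr0 P (fun p => \int[@lebesgue_rV R d]_t
      (`|\1_(dil beta (z * c p) @` AB p) t - \1_(Ainf p) t|
         * expR (- (1 - delta) * G p t))%:E)%E @[z --> +oo] --> 0%E)
  (delta0 : R) (Hdelta0 : delta0 < 1)
  (HRem_small : forall p s, P p -> AB p s -> `|Rem p s| <= delta0)
  (Hb_bounded : exists K : R, forall p s, P p -> AB p s -> normc (b p s) <= K)
  (b0 : N -> R[i]) (Hb0_meas : cmeasurable_fun P b0)
  (Hb0_bounded : exists K : R, forall p, P p -> normc (b0 p) <= K)
  (Hb0_lim :
    supr0 P (fun p => supr0 [set s | A p s /\ rho beta s <= r]
      (fun s => (normc (b p s - b0 p))%:E)) @[r --> 0^'+] --> 0%E)
  (I : R -> N -> R[i] := fun z p => cell_integral D f a k z p)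
  (L : N -> R[i] := fun p =>
    b0 p * (\int[@lebesgue_rV R d]_(t in Ainf p) expR (- G p t))%:C%C) :
  [/\ supr0 P (fun p =>
        (normc ((expR (z * f0) * (z * c p) `^ Q)%:C%C * I z p - L p))%:E)
        @[z --> +oo] --> 0%E,
      exists r : R -> N -> R[i],
        supr0 P (fun p => (normc (r z p))%:E) @[z --> +oo] --> 0%E /\
        forall z p, 0 < z -> P p ->
          I z p = (expR (- z * f0) * z `^ (- Q) * c p `^ (- Q))%:C%C
                  * (L p + r z p) &
      (0 < ereal_inf [set (normc (L p))%:E | p in P])%E ->
      supr0 P (fun p =>
        (normc (I z p / ((expR (- z * f0) * (z * c p) `^ (- Q))%:C%C * L p)
                - 1))%:E)
        @[z --> +oo] --> 0%E].
Proof.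
have d0 : (0 < d)%N by [].
have P_meas : measurable P by exact: (base_measurable _ _ _ _ _ _ _ _ _ HD).
have [Ka hKa] := Hb_bounded; have [Kb hKb] := Hb0_bounded.
(* The given bounds may be negative when nothing is to be bounded; the cutoff at 0 makes K >= 0. The
   same cutoff of [delta0] below gives th <= 1. *)
pose K := Num.max 0 (Num.max Ka Kb).
have K0 : 0 <= K by rewrite le_max lexx.
have b_le p s : P p -> AB p s -> normc (b p s) <= K.
  by move=> Pp Bs; rewrite !le_max (hKa p s Pp Bs) orbT.
have b0_le p : P p -> normc (b0 p) <= K.
  by move=> Pp; rewrite !le_max (hKb p Pp) !orbT.
pose th := 1 - Num.max 0 delta0.
have th01 : 0 < th <= 1.
  by rewrite /th subr_gt0 gt_max ltr01 Hdelta0 lerBlDr lerDl le_max lexx.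
have rem_le p s : P p -> AB p s -> `|Rem p s| <= 1 - th.
  by move=> Pp Bs; rewrite /th opprB addrC subrK le_max HRem_small ?orbT.
have G_ge p t : P p -> gmin * rho beta t <= G p t.
  move=> Pp; apply: homogeneous_ge_rho => //.
  - by move=> t' u u0; exact: HG_hom.
  - by move=> t' /(HG p t' Pp)/andP[].
  - by move=> t'; exact: HG_ge0.
have mAB p : P p -> measurable (AB p) by exact: measurable_tcell HD k p.
have mAinf p : P p -> measurable (Ainf p).
  move=> Pp; have := measurable_xsection (p : borel N) HAinf_meas.
  by congr measurable; apply/seteqP; split=> s; rewrite /xsection/= inE; [case|split].
have mG p : P p -> measurable_fun setT (G p).
  move=> Pp; have mp : measurable_fun setT (fun t : 'rV[R]_d => (p : borel N, t)).
    exact: pair1_measurable.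
  apply: (measurable_comp (measurableX P_meas measurableT) _ HG_meas mp).
  by move=> _ [s _ <-].
have mF p : P p -> measurable_fun (AB p) (F p : _ -> borel N).
  by move=> Pp; exact: (measurable_nmap HD k p HSigma Pp).
have mphi p : P p -> measurable_fun (AB p) (fun s => f (F p s) - f0).
  move=> Pp; apply: measurable_funB => //.
  exact: (measurableT_comp (continuous_borel_measurable _ _ Hf) (mF p Pp)).
have c_gt p : P p -> 0 < c p by move=> /Hc/andP[h _]; exact: lt_le_trans h.
have AB_A p s : AB p s -> A p s by case.
have near0 (eta : R) : 0 < eta -> exists2 r, 0 < r & forall p s, P p -> AB p s ->
    rho beta s <= r -> `|Rem p s| <= eta /\ normc (b p s - b0 p) <= eta.
  move=> eta0.
  have [r [[h1 h2] r0]] := @filter_ex _ _ _ _ (filterI (filterI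
    (cvge0_near _ _ HRem_lim eta0) (cvge0_near _ _ Hb0_lim eta0))
    (nbhs_right_gt 0)).
  exists r => // p s Pp Bs sr; rewrite -!lee_fin; split.
    apply: le_trans (ltW h1); apply: le_trans (supr0_ub _ _ p Pp).
    exact: (supr0_ub [set s | A p s /\ rho beta s <= r]
      (fun s => `|Rem p s|%:E) s (conj (AB_A _ _ Bs) sr)).
  apply: le_trans (ltW h2); apply: le_trans (supr0_ub _ _ p Pp).
  exact: (supr0_ub [set s | A p s /\ rho beta s <= r]
      (fun s => (normc (b p s - b0 p))%:E) s (conj (AB_A _ _ Bs) sr)).
have nearC (eta : R) : 0 < eta -> \forall z \near +oo, forall p, P p ->
    (\int[lebesgue_rV R d]_t (`|\1_(dil beta (z * c p) @` AB p) t - \1_(Ainf p) t|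
      * expR (- (1 - 2^-1) * G p t))%:E <= eta%:E)%E.
  move=> eta0; have h2 := half_itv R.
  apply: filterS (cvge0_near _ _ (HAinf _ h2) eta0) => z hz p Pp.
  by apply: le_trans (ltW hz); exact: (supr0_ub P _ p Pp).
(* [w] stands for the real or the imaginary part; the listed properties are those shared by both, so
   the real estimate is derived once. *)
have key (w : R[i] -> R) : (forall x, `|w x| <= normc x) ->
    (forall x y, w (x - y) = w x - w y) ->
    (forall x r, w (x * r%:C%C) = w x * r) ->
    measurable_fun setT (w \o a : borel N -> R) ->
    forall e, 0 < e -> \forall z \near +oo, forall p, P p ->
    `|expR (z * f0) * (z * c p) `^ Q *
        \int[lebesgue_rV R d]_(s in AB p) w (b p s * (expR (- z * f (F p s)))%:C%C) -
      w (L p)| <= e.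
  move=> w_le wB wM mwa e e0.
  have mwb p : P p -> measurable_fun (AB p) (fun s => w (b p s)).
    move=> Pp; under eq_fun do rewrite wM.
    apply: measurable_funM; last exact: (measurable_jac HD).
    exact: (measurableT_comp mwa (mF p Pp)).
  have phiE p s : P p -> AB p s -> f (F p s) - f0 = c p * G p s * (1 + Rem p s) by exact: Hexp.
  have near0' (eta : R) : 0 < eta -> exists2 r, 0 < r & forall p s, P p -> AB p s ->
      rho beta s <= r -> `|Rem p s| <= eta /\ `|w (b p s) - w (b0 p)| <= eta.
    move=> /near0[r r0 hr]; exists r => // p s Pp Bs sr.
    have [h1 h2] := hr p s Pp Bs sr; split=> //; rewrite -wB.
    exact: le_trans h2.
  have wb_le p s : P p -> AB p s -> `|w (b p s)| <= K.
    by move=> Pp Bs; apply: le_trans (b_le p s Pp Bs).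
  have wb0_le p : P p -> `|w (b0 p)| <= K.
    by move=> Pp; apply: le_trans (b0_le p Pp).
  have hul := @uniform_laplace R d beta N P AB Ainf c (fun p => w (b0 p)) G Rem
    (fun p s => w (b p s)) (fun p s => f (F p s) - f0) cmin K th gmin d0 Hbeta Hcmin
    K0 th01 Hgmin (fun p Pp => proj1 (andP (Hc p Pp))) mAB mAinf mG mwb mphi
    HG_hom G_ge rem_le phiE wb_le wb0_le near0' nearC e e0.
  apply: filterS2 (nbhs_pinfty_gt (num_real (0 : R))) hul => z z0 hz p Pp.
  have [th0 _] := andP th01.
  have u0 : 0 < z * c p by rewrite mulr_gt0// c_gt.
  (* Integrability justifies pulling the constant e^(-z f0) out of the integral below. *)
  have iphi := @integrable_laplace R d beta d0 Hbeta (z * c p) K th gmin (AB p) (G p)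
    (Rem p) (fun s => w (b p s)) (fun s => z * (f (F p s) - f0)) u0 K0 th0 Hgmin (mAB p Pp)
    (mwb p Pp) (measurable_funM (measurable_cst z) (mphi p Pp))
    (fun t v => HG_hom p t v Pp) (fun t => G_ge p t Pp) (fun s => rem_le p s Pp)
    _ (fun s => wb_le p s Pp).
  have phiE' s : AB p s -> z * (f (F p s) - f0) = z * c p * G p s * (1 + Rem p s).
    by move=> Bs; rewrite Hexp// !mulrA.
  have {}iphi := iphi phiE'.
  rewrite /L wM.
  have -> : \int[lebesgue_rV R d]_(s in AB p) w (b p s * (expR (- z * f (F p s)))%:C%C) =
      \int[lebesgue_rV R d]_(s in AB p)
        (expR (- z * f0) * (w (b p s) * expR (- (z * (f (F p s) - f0))))).
    apply: eq_Rintegral => s _; rewrite wM mulrCA -expRD.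
    by congr (_ * expR _); rewrite mulrBr mulNr; ring.
  rewrite RintegralZl//; last exact: mAB.
  rewrite mulrACA.
  have -> : expR (z * f0) * expR (- z * f0) = 1 by rewrite -expRD mulNr subrr expR0.
  by rewrite mul1r; exact: hz.
have lim1 : supr0 P (fun p =>
    (normc ((expR (z * f0) * (z * c p) `^ Q)%:C%C * I z p - L p))%:E)
    @[z --> +oo] --> 0%E.
  apply: near_cvge0 => [z|e e0]; first exact: supr0_ge0.
  have e2 : 0 < e / 2 by rewrite divr_gt0.
  have [mRe mIm] := Ha.
  apply: filterS2 (key _ normr_Re_le ReB Re_mulC mRe _ e2)
    (key _ normr_Im_le ImB Im_mulC mIm _ e2) => z hRe hIm.
  apply: supr0_le; first by rewrite lee_fin ltW.
  move=> p Pp; rewrite lee_fin (le_trans (normc_le_ReD _))// [leRHS]splitr.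
  rewrite ReB ImB [_%:C%C * _]mulrC Re_mulC Im_mulC ![complex.Re _ * _]mulrC.
  rewrite ![complex.Im _ * _]mulrC.
  by apply: lerD; [exact: hRe|exact: hIm].
have scalE z p : 0 < z -> P p ->
    (expR (- z * f0) * (z * c p) `^ (- Q))%:C%C *
    (expR (z * f0) * (z * c p) `^ Q)%:C%C = 1 :> R[i].
  move=> z0 Pp; rewrite -rmorphM mulrACA -expRD mulNr addNr expR0 mul1r powRN mulVf//.
  by rewrite gt_eqF// powR_gt0// mulr_gt0// c_gt.
split=> //.
  (* The witness is the very difference controlled by [lim1]; [scalE] inverts the prefactor. *)
  exists (fun z p => (expR (z * f0) * (z * c p) `^ Q)%:C%C * I z p - L p); split=> // z p z0 Pp.
  rewrite addrC subrK mulrA.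
  have -> : expR (- z * f0) * z `^ (- Q) * c p `^ (- Q) =
      expR (- z * f0) * (z * c p) `^ (- Q).
    by rewrite -mulrA -powRM// ltW// c_gt.
  by rewrite scalE// mul1r.
move=> Lgt0.
have [m m0 hm] : exists2 m : R, 0 < m & forall p, P p -> m <= normc (L p).
  move: Lgt0; set i := ereal_inf _ => i0.
  have hi p : P p -> (i <= (normc (L p))%:E)%E.
    by move=> Pp; apply: ereal_inf_lbound; exists p.
  move: i0 hi; case: i => [m|_|//]; first by rewrite lte_fin => m0 hi; exists m.
  (* An infinite infimum forces P to be empty, as moduli are finite, so any positive m will do. *)
  by move=> hi; exists 1 => // p /hi; rewrite leye_eq.
apply: near_cvge0 => [z|e e0]; first exact: supr0_ge0.
(* The relative error is the absolute one divided by |L(p)| >= m, hence the tolerance e m. *)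
have em0 : 0 < e * m by rewrite mulr_gt0.
apply: filterS2 (nbhs_pinfty_gt (num_real (0 : R))) (cvge0_near _ _ lim1 em0) => z z0 hz.
apply: supr0_le; first by rewrite lee_fin ltW.
move=> p Pp; have Lp0 : 0 < normc (L p) by apply: lt_le_trans (hm p Pp).
have L0 : L p != 0.
  by apply: contraTneq Lp0 => ->; rewrite ComplexField.Normc.normc0 ltxx.
set s := (expR (- z * f0) * (z * c p) `^ (- Q))%:C%C.
have sE := scalE z p z0 Pp; rewrite -/s in sE.
have s0 : s != 0 by apply: contra_eq_neq sE => ->; rewrite mul0r eq_sym oner_eq0.
have -> : I z p / (s * L p) - 1 =
    ((expR (z * f0) * (z * c p) `^ Q)%:C%C * I z p - L p) * (L p)^-1.
  rewrite mulrBl mulfV// invfM; congr (_ - _).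
  have -> : s^-1 = (expR (z * f0) * (z * c p) `^ Q)%:C%C.
    by apply: (mulfI s0); rewrite sE mulfV.
  by rewrite mulrA [I z p * _]mulrC.
rewrite ComplexField.Normc.normcM ComplexField.Normc.normcV lee_fin ler_pdivrMr//.
rewrite -lee_fin; apply: (@le_trans _ _ (e * m)%:E); last first.
  by rewrite lee_fin ler_wpM2l ?(ltW e0)// hm.
by apply: le_trans (ltW hz); exact: (supr0_ub P _ p Pp).
Qed.
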